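(* Let $\mathbf{B}$ be a unital ring. The functor $$\Phi\colon \mathrm{Fun}(\mathfrak{XMod},\mathfrak{Mod})\to \mathrm{Lin}(\mathfrak{Laby},\mathfrak{Mod})$$ defined below is well defined (i.e. $\Phi(F)$ is an additive functor $\mathfrak{Laby}\to\mathfrak{Mod}$ for every module functor $F$, and $\Phi$ is a functor), and it is an equivalence of categories. Here, for a module functor $F$, $\Phi(F)$ takes a finite set $X$ to $\mathrm{cr}_X F(\mathbf{B})$ and a maze $P\colon X\to Y$ to the map $\mathrm{cr}_XF(\mathbf{B})\to\mathrm{cr}_YF(\mathbf{B})$ obtained by restricting $$F\Big(\mathop{\diamond}_{p\in P}\ \overline{p}\,\sigma_{y_px_p}\Big)\colon F(\mathbf{B}^X)\to F(\mathbf{B}^Y)$$ (where $p\colon x_p\to y_p$ runs over the passage occurrences of $P$; this restriction takes values in $\mathrm{cr}_YF(\mathbf{B})$); and for a natural transformation $\zeta\colon F\to G$, $\Phi(\zeta)_X$ is the restriction of $\zeta_{\mathbf{B}^X}$ to $\mathrm{cr}_XF(\mathbf{B})\to \mathrm{cr}_XG(\mathbf{B})$.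
   Context: Maps/modules: $\mathfrak{XMod}$ is the category of finitely generated free right $\mathbf{B}$-modules with right-module homomorphisms, $\mathfrak{Mod}$ the category of all $\mathbf{B}$-modules. A module functor is an arbitrary (not necessarily additive) functor $F\colon\mathfrak{XMod}\to\mathfrak{Mod}$; $\mathrm{Fun}(\mathfrak{XMod},\mathfrak{Mod})$ is the category of module functors and natural transformations. For homomorphisms $\alpha_1,\dots,\alpha_k\colon M\to N$ set $F(\alpha_1\diamond\cdots\diamond\alpha_k)=\sum_{I\subseteq\{1,\dots,k\}}(-1)^{k-|I|}F\big(\sum_{i\in I}\alpha_i\big)$. For a finite set $X$, $\mathbf{B}^X$ is free with basis $(e_x)_{x\in X}$; for $x\in X$, $y\in Y$, $b\in\mathbf{B}$, $b\sigma_{yx}\colon\mathbf{B}^X\to\mathbf{B}^Y$ is the right-module map with $e_x\mapsto e_yb$ and $e_{x'}\mapsto0$ for $x'\neq x$; $\pi_x=\sigma_{xx}\colon\mathbf{B}^X\to\mathbf{B}^X$. The cross-effect of rank $X$ evaluated on $\mathbf{B}$ is $\mathrm{cr}_XF(\mathbf{B})=\operatorname{Im}F(\diamond_{x\in X}\pi_x)\subseteq F(\mathbf{B}^X)$. Mazes: A passage $p\colon x\to y$ from an element $x$ of a finite set $X$ to an element $y$ of a finite set $Y$ is a formal arrow with a label $\overline p\in\mathbf{B}$. A maze $P\colon X\to Y$ is a finite multi-set of passages from elements of $X$ to elements of $Y$ such that every element of $X$ is the source of some passage of $P$ and every element of $Y$ the target of some passage of $P$ (the empty maze $\emptyset\to\emptyset$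 is allowed); $|P|$ is its number of passages counted with multiplicity. For mazes $P\colon Y\to Z$, $Q\colon X\to Y$, $P\boxtimes Q$ is the multi-set of pairs $(p,q)$ of passage occurrences $p\in P$, $q\in Q$ with target of $q$ equal to the source of $p$; for a sub-multi-set $U\subseteq P\boxtimes Q$ write $U\sqsubseteq P\boxtimes Q$ if every passage occurrence of $P$ and every one of $Q$ occurs in some pair of $U$; such a $U$ is identified with the maze $X\to Z$ having, for each pair $(p\colon y\to z,\ q\colon x\to y)\in U$, a passage $x\to z$ labelled $\overline p\,\overline q$. Composition: $P\circ Q=\sum_{U\sqsubseteq P\boxtimes Q}U$. Labyrinth category $\mathfrak{Laby}$: objects are formal finite direct sums of finite sets; for finite sets $X,Y$, $\mathfrak{Laby}(X,Y)$ is the abelian group generated by mazes $X\to Y$ modulo the relations, for every multi-set $P$ of passages, $x\in X$, $y\in Y$, $a,b\in\mathbf{B}$ (whenever the terms are mazes; $\cup$ denotes multi-set sum): (I) $P\cup\{x\xrightarrow{0}y\}=0$; (II) $P\cup\{x\xrightarrow{a+b}y\}=P\cup\{x\xrightarrow{a}y\}+P\cup\{x\xrightarrow{b}y\}+P\cup\{x\xrightarrow{a}y,\ x\xrightarrow{b}y\}$. Composition is extended bilinearly, morphisms between direct sums are matrices, and the identity of $X$ is $I_X=\{x\xrightarrow{1}x : x\in X\}$. $\mathrm{Lin}(\mathfrak{Laby},\mathfrak{Mod})$ denotes the category of additive functors $\mathfrak{Laby}\to\mathfrak{Mod}$ (determined by their values on finite sets and mazes). *)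

(* Defs.v *)
From Stdlib Require Import FunctionalExtensionality ProofIrrelevance ClassicalEpsilon.
From HB Require Import structures.
From mathcomp Require Import all_boot all_algebra.
Set Implicit Arguments. Unset Strict Implicit. Unset Printing Implicit Defensive.
Import GRing.Theory.
Local Open Scope ring_scope.

Section Laby.
Variable B : pzRingType.

Record rmod := RMod {
  mcar :> Type;
  madd : mcar -> mcar -> mcar;
  mzero : mcar;
  mopp : mcar -> mcar;
  mact : mcar -> B -> mcar;
  maddA : forall x y z, madd x (madd y z) = madd (madd x y) z;
  maddC : forall x y, madd x y = madd y x;
  madd0 : forall x, madd mzero x = x;
  maddN : forall x, madd (mopp x) x = mzero;
  mactDl : forall x y b, mact (madd x y) b = madd (mact x b) (mact y b);
  mactDr : forall x a b, mact x (a + b) = madd (mact x a) (mact x b);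
  mactM : forall x a b, mact x (a * b) = mact (mact x a) b;
  mact1 : forall x, mact x 1 = x }.

Arguments madd {r}. Arguments mzero {r}. Arguments mopp {r}. Arguments mact {r}.

Record mhom (M N : rmod) := MHom {
  hfun :> M -> N;
  hfunD : forall x y, hfun (madd x y) = madd (hfun x) (hfun y);
  hfunA : forall x b, hfun (mact x b) = mact (hfun x) b }.

Section ModLemmas.
Variable M : rmod.
Implicit Types x y a c d : M.
Lemma maddr0 x : madd x mzero = x. Proof. by rewrite maddC madd0. Qed.
Lemma maddrN x : madd x (mopp x) = mzero. Proof. by rewrite maddC maddN. Qed.
Lemma maddKl a c : madd (mopp a) (madd a c) = c.
Proof. by rewrite maddA maddN madd0. Qed.
Lemma madd_cancel a c d : madd a c = madd a d -> c = d.
Proof. by move=> h; rewrite -(maddKl a c) h maddKl. Qed.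
Lemma madd_eq0 a c : madd a c = mzero -> a = mopp c.
Proof. by move=> h; rewrite -(maddr0 a) -(maddrN c) maddA h madd0. Qed.
Lemma maddACA a c x y : madd (madd a c) (madd x y) = madd (madd a x) (madd c y).
Proof. by rewrite -!maddA; congr madd; rewrite !maddA (maddC c x). Qed.
Lemma moppD x y : mopp (madd x y) = madd (mopp x) (mopp y).
Proof. by symmetry; apply: madd_eq0; rewrite maddACA !maddN madd0. Qed.
End ModLemmas.

Section AddFun.
Variables (M N : rmod) (g : M -> N).
Hypothesis gD : forall x y, g (madd x y) = madd (g x) (g y).
Lemma add_fun0 : g mzero = mzero.
Proof. by apply: (@madd_cancel _ (g mzero)); rewrite -gD madd0 maddr0. Qed.
Lemma add_funN x : g (mopp x) = mopp (g x).
Proof. by apply: madd_eq0; rewrite -gD maddN add_fun0. Qed.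
End AddFun.

Lemma mact0 (M : rmod) b : mact (@mzero M) b = mzero.
Proof. exact: (add_fun0 (g := fun x => mact x b) (fun x y => mactDl x y b)). Qed.
Lemma mactN (M : rmod) (x : M) b : mact (mopp x) b = mopp (mact x b).
Proof. exact: (add_funN (g := fun x => mact x b) (fun x y => mactDl x y b)). Qed.

Definition hid (M : rmod) : mhom M M := @MHom M M (fun x => x) (fun _ _ => erefl) (fun _ _ => erefl).
Definition hcomp (M N P : rmod) (g : mhom N P) (f : mhom M N) : mhom M P.
Proof. refine (@MHom M P (fun x => g (f x)) _ _) => *; by rewrite !(hfunD, hfunA). Defined.
Definition hzero (M N : rmod) : mhom M N.
Proof. refine (@MHom M N (fun _ => mzero) _ _) => *; by rewrite ?madd0 ?mact0. Defined.
Definition hadd (M N : rmod) (f g : mhom M N) : mhom M N.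
Proof.
refine (@MHom M N (fun x => madd (f x) (g x)) _ _) => *.
  by rewrite !hfunD maddACA.
by rewrite !hfunA mactDl.
Defined.
Definition hopp (M N : rmod) (f : mhom M N) : mhom M N.
Proof.
refine (@MHom M N (fun x => mopp (f x)) _ _) => *.
  by rewrite hfunD moppD.
by rewrite hfunA mactN.
Defined.
Definition hsumL (M N : rmod) (T : Type) (s : seq T) (a : T -> mhom M N) : mhom M N :=
  foldr (fun t acc => hadd (a t) acc) (hzero M N) s.
Definition hsign (M N : rmod) (n : nat) (h : mhom M N) : mhom M N :=
  if odd n then hopp h else h.
Definition msum (M : rmod) (T : Type) (s : seq T) (f : T -> M) : M :=
  foldr (fun t acc => madd (f t) acc) mzero s.

Definition is_free (M : rmod) : Prop :=
  exists (I : finType) (e : I -> M),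
    bijective (fun c : I -> B => msum (enum I) (fun i => mact (e i) (c i))).

Record xobj := XObj { xmod :> rmod; xfree : is_free xmod }.

Definition funmod (X : Type) : rmod.
Proof.
refine (@RMod (X -> B) (fun f g x => f x + g x) (fun _ => 0) (fun f x => - f x)
          (fun f b x => f x * b) _ _ _ _ _ _ _ _) => *;
  apply: functional_extensionality => ?.
- exact: addrA.
- exact: addrC.
- exact: add0r.
- exact: addNr.
- exact: mulrDl.
- exact: mulrDr.
- exact: mulrA.
- exact: mulr1.
Defined.

Definition ebasis (X : finType) (x : X) : funmod X := fun x' => if x' == x then 1 else 0.

Lemma msum_eval (X : Type) (T : Type) (s : seq T) (f : T -> funmod X) y :
  (msum s f : funmod X) y = \sum_(t <- s) f t y.
Proof. by elim: s => [|t s IH] /=; rewrite ?big_nil ?big_cons //= IH. Qed.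

Lemma free_funmod (X : finType) : is_free (funmod X).
Proof.
exists X, (@ebasis X).
have E : forall c : X -> B, msum (enum X) (fun i => mact (ebasis i) (c i)) = c.
  move=> c; apply: functional_extensionality => y.
  rewrite msum_eval big_enum /= (bigD1 y) //= /ebasis eqxx mul1r big1 ?addr0 //.
  by move=> i; rewrite eq_sym => /negbTE ->; rewrite mul0r.
by exists (fun c => c) => c /=; rewrite E.
Qed.

Definition BX (X : finType) : xobj := XObj (free_funmod X).

(* b sigma_{yx} : B^X -> B^Y,  e_x |-> e_y b,  e_x' |-> 0 (x' <> x) *)
Definition sigma (X Y : finType) (x : X) (y : Y) (b : B) : mhom (BX X) (BX Y).
Proof.
refine (@MHom (BX X) (BX Y)
          (fun v : funmod X => (fun y' => if y' == y then b * v x else 0) : funmod Y) _ _)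
  => * /=; apply: functional_extensionality => y' /=; case: (y' == y).
- exact: mulrDr.
- by rewrite addr0.
- exact: mulrA.
- by rewrite mul0r.
Defined.

Definition piX (X : finType) (x : X) : mhom (BX X) (BX X) := sigma x x 1.

Record modfun := ModFun {
  Fo : xobj -> rmod;
  Fm : forall M N : xobj, mhom M N -> mhom (Fo M) (Fo N);
  Fm_id : forall (M : xobj) x, Fm (hid M) x = x;
  Fm_comp : forall (M N P : xobj) (g : mhom N P) (f : mhom M N) x,
      Fm (hcomp g f) x = Fm g (Fm f x) }.

Record nattr (F G : modfun) := NatTr {
  ntc : forall M : xobj, mhom (Fo F M) (Fo G M);
  ntnat : forall (M N : xobj) (f : mhom M N) x, ntc N (Fm F f x) = Fm G f (ntc M x) }.

Definition nt_id (F : modfun) : nattr F F :=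
  @NatTr F F (fun M => hid (Fo F M)) (fun _ _ _ _ => erefl).
Definition nt_comp (F G H : modfun) (z : nattr G H) (w : nattr F G) : nattr F H.
Proof.
refine (@NatTr F H (fun M => hcomp (ntc z M) (ntc w M)) _) => M N f x /=.
by rewrite !ntnat.
Defined.

Definition dia (F : modfun) (M N : xobj) (I : finType) (a : I -> mhom M N)
  : mhom (Fo F M) (Fo F N) :=
  hsumL (enum {set I}) (fun S => hsign (#|I| - #|S|) (Fm F (hsumL (enum S) a))).

Section Image.
Variables (M N : rmod) (f : mhom M N).
Definition imgP (y : N) : Prop := exists x, y = f x.
Lemma imgD a b : imgP a -> imgP b -> imgP (madd a b).
Proof. by case=> x -> [y ->]; exists (madd x y); rewrite hfunD. Qed.
Lemma img0 : imgP mzero.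
Proof. by exists mzero; rewrite (add_fun0 (hfunD f)). Qed.
Lemma imgN a : imgP a -> imgP (mopp a).
Proof. by case=> x ->; exists (mopp x); rewrite (add_funN (hfunD f)). Qed.
Lemma imgA a b : imgP a -> imgP (mact a b).
Proof. by case=> x ->; exists (mact x b); rewrite hfunA. Qed.
Lemma sig_eq (a c : {y : N | imgP y}) : sval a = sval c -> a = c.
Proof. by case: a => a pa; case: c => c pc /= e; subst; f_equal; apply: proof_irrelevance. Qed.
Definition imgmod : rmod.
Proof.
refine (@RMod {y : N | imgP y}
  (fun a c => exist _ (madd (sval a) (sval c)) (imgD (proj2_sig a) (proj2_sig c)))
  (exist _ mzero img0)
  (fun a => exist _ (mopp (sval a)) (imgN (proj2_sig a)))
  (fun a b => exist _ (mact (sval a) b) (imgA b (proj2_sig a))) _ _ _ _ _ _ _ _)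
  => *; apply: sig_eq => /=.
- exact: maddA.
- exact: maddC.
- exact: madd0.
- exact: maddN.
- exact: mactDl.
- exact: mactDr.
- exact: mactM.
- exact: mact1.
Defined.
End Image.

Definition crP (F : modfun) (X : finType) : Fo F (BX X) -> Prop :=
  imgP (dia F (@piX X)).
Definition cr (F : modfun) (X : finType) : rmod := imgmod (dia F (@piX X)).
Arguments crP : clear implicits.
Arguments cr : clear implicits.

(* Mazes: a maze X -> Y is a finite multiset of labelled passages,
   represented as a sequence of (source, target, label), considered up
   to permutation (see perm_eq in the laws below).                    *)
Definition is_maze (X Y : finType) (P : seq (X * Y * B)) : Prop :=
  (forall x : X, has (fun p => p.1.1 == x) P) /\ (forall y : Y, has (fun p => p.1.2 == y) P).

Definition mazehoms (X Y : finType) (P : seq (X * Y * B)) (i : 'I_(size P))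
  : mhom (BX X) (BX Y) :=
  let p := tnth (in_tuple P) i in sigma p.1.1 p.1.2 p.2.
Arguments mazehoms {X Y} P i.

Section Compose.
Variables (X Y Z : finType) (P : seq (Y * Z * B)) (Q : seq (X * Y * B)).
Definition mcompat (ij : 'I_(size P) * 'I_(size Q)) : bool :=
  (tnth (in_tuple P) ij.1).1.1 == (tnth (in_tuple Q) ij.2).1.2.
Definition mvalid (S : {set 'I_(size P) * 'I_(size Q)}) : bool :=
  [&& [forall ij in S, mcompat ij],
      [forall i, exists j, (i, j) \in S] &
      [forall j, exists i, (i, j) \in S]].
Definition Umaze (S : {set 'I_(size P) * 'I_(size Q)}) : seq (X * Z * B) :=
  [seq ((tnth (in_tuple Q) ij.2).1.1, (tnth (in_tuple P) ij.1).1.2,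
        (tnth (in_tuple P) ij.1).2 * (tnth (in_tuple Q) ij.2).2) | ij <- enum S].
End Compose.

Definition mazeI (X : finType) : seq (X * X * B) := [seq (x, x, 1) | x <- enum X].

(* Data of a (would-be) additive functor Laby -> Mod, given on finite sets
   and mazes. *)
Record mrep := MRep {
  Lo : finType -> rmod;
  Lm : forall X Y : finType, seq (X * Y * B) -> Lo X -> Lo Y }.
Arguments Lo : clear implicits.
Arguments Lm m {X Y} _ _.

Record linrep_laws (L : mrep) : Prop := {
  lr_add : forall (X Y : finType) (P : seq (X * Y * B)), is_maze P ->
    forall u v, Lm L P (madd u v) = madd (Lm L P u) (Lm L P v);
  lr_act : forall (X Y : finType) (P : seq (X * Y * B)), is_maze P ->
    forall u b, Lm L P (mact u b) = mact (Lm L P u) b;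
  lr_perm : forall (X Y : finType) (P P' : seq (X * Y * B)), is_maze P ->
    perm_eq P P' -> forall v, Lm L P v = Lm L P' v;
  lr_relI : forall (X Y : finType) (P : seq (X * Y * B)) (x : X) (y : Y),
    is_maze (rcons P (x, y, 0)) -> forall v, Lm L (rcons P (x, y, 0)) v = mzero;
  lr_relII : forall (X Y : finType) (P : seq (X * Y * B)) (x : X) (y : Y) (a b : B),
    is_maze (rcons P (x, y, a)) -> forall v,
    Lm L (rcons P (x, y, a + b)) v =
      madd (madd (Lm L (rcons P (x, y, a)) v) (Lm L (rcons P (x, y, b)) v))
           (Lm L (rcons (rcons P (x, y, a)) (x, y, b)) v);
  lr_comp : forall (X Y Z : finType) (P : seq (Y * Z * B)) (Q : seq (X * Y * B)),
    is_maze P -> is_maze Q -> forall v,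
    Lm L P (Lm L Q v) =
      msum [seq S <- enum {set 'I_(size P) * 'I_(size Q)} | mvalid S]
           (fun S => Lm L (Umaze S) v);
  lr_id : forall (X : finType) v, Lm L (mazeI X) v = v }.

Record repmorph_laws (L L' : mrep) (e : forall X : finType, Lo L X -> Lo L' X) : Prop := {
  rm_add : forall X u v, e X (madd u v) = madd (e X u) (e X v);
  rm_act : forall X u b, e X (mact u b) = mact (e X u) b;
  rm_nat : forall (X Y : finType) (P : seq (X * Y * B)), is_maze P ->
    forall v, e Y (Lm L P v) = Lm L' P (e X v) }.

Definition rep_iso (L L' : mrep) : Prop :=
  exists (e : forall X, Lo L X -> Lo L' X) (e' : forall X, Lo L' X -> Lo L X),
    [/\ repmorph_laws e, repmorph_laws e',
        forall X v, e' X (e X v) = v & forall X v, e X (e' X v) = v].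

(* The functor Phi.  Restrictions are defined by informative excluded
   middle (value 0 outside the case where the value lies in the cross
   effect); the main theorem asserts that this case never happens.    *)
Definition phiLm (F : modfun) (X Y : finType) (P : seq (X * Y * B)) (v : cr F X)
  : cr F Y :=
  match excluded_middle_informative (crP F Y (dia F (mazehoms P) (sval v))) with
  | left h => exist _ _ h
  | right _ => mzero
  end.

Arguments phiLm F {X Y} P v.

Definition Phi (F : modfun) : mrep := @MRep (cr F) (@phiLm F).

Definition phi_nt (F G : modfun) (z : nattr F G) (X : finType) (v : Lo (Phi F) X)
  : Lo (Phi G) X :=
  match excluded_middle_informative (crP G X (ntc z (BX X) (sval v))) with
  | left h => exist _ _ h
  | right _ => mzero
  end.

End Laby.

Arguments Lo {B} m _.
Arguments Lm {B} m {X Y} _ _.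
Arguments crP {B} F X _.
Arguments cr {B} F X.
Arguments phiLm {B} F {X Y} P v.
Arguments mazehoms {B X Y} P i.
Arguments BX {B} X.
Arguments funmod {B} X.

(* Main.v *)
From Stdlib Require Import ClassicalEpsilon.
From HB Require Import structures.
Require Import Defs.
From mathcomp Require Import all_boot all_algebra.
From mathcomp Require Import boolp.
Set Implicit Arguments. Unset Strict Implicit. Unset Printing Implicit Defensive.
Import GRing.Theory.
Local Open Scope ring_scope.

(** The deviation F(a_1 <> ... <> a_k) is the image of the product of the
    ([a_i] - 1) under the linear extension of F to the group ring of Hom(M, N).
    Hence F(sum_(i in A) a_i) is the sum of the deviations over all subsets of A,
    and Moebius inversion turns functoriality of F into the maze composition law.
    Evaluated at id = sum_x pi_x this splits F(B^X) into copies of the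
    cr_S F(B), S a subset of X, and every F(f) is a sum of deviations of
    families of passages; so natural transformations are determined by, and can
    be prescribed on, the cross-effects.  Conversely, given L, put
    F(B^X) = prod_(S <= X) L(S) and let F(f) have as (S, T) component the sum of
    L(P) over all mazes P : S -> T contained in the matrix of f.  By the relations
    (I) and (II) this sum may be computed from any multiset of passages with
    sum f, which gives functoriality, and Moebius inversion identifies the
    deviation of F along a maze P with L(P). *)

(** * Sums over subsets and deviations *)

(** Two mismatches shape the proof. Maze composition is stated over positions of lists, while
    Moebius inversion varies subsets of a fixed index set; hence multi-sets are mostly handled as
    families [p : I -> X * Y * B] cut down to a set A. And a sub-multi-set of a matrix is rarely a
    maze from X to Y: it is one from its set of sources to its set of targets, so deviations are
    taken for all multi-sets and these two sets are tracked as the coordinates of a block. The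
    covering condition in maze composition appears when subsets of a product are sorted by their two
    projections. *)

Lemma perm_enum_imset (I J : finType) (f : I -> J) (A : {set I}) :
  injective f -> perm_eq (enum (f @: A)) (map f (enum A)).
Proof.
move=> f_inj; apply: uniq_perm; rewrite ?map_inj_uniq ?enum_uniq // => y.
by rewrite mem_enum; apply/imsetP/mapP => -[x xA ->]; exists x; rewrite ?mem_enum // -mem_enum.
Qed.

Lemma perm_enum_setU1 (I : finType) (i : I) (A : {set I}) :
  i \notin A -> perm_eq (enum (i |: A)) (i :: enum A).
Proof.
move=> iA; apply: uniq_perm; rewrite /= ?enum_uniq ?mem_enum ?iA //.
by move=> x; rewrite inE !mem_enum !inE.
Qed.

Lemma perm_swap (T : eqType) (x y : T) s : perm_eq [:: x, y & s] [:: y, x & s].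
Proof. by rewrite -[[:: x, y & s]]/([:: x] ++ [:: y] ++ s) perm_catCA. Qed.

Section SubsetSums.
Variable V : zmodType.

Lemma sum_subsetU1 (I : finType) (i : I) (S : {set I}) (G : {set I} -> V) :
  i \notin S ->
  \sum_(T : {set I} | T \subset i |: S) G T =
  \sum_(T : {set I} | T \subset S) (G T + G (i |: T)).
Proof.
move=> iS; rewrite big_split /= (bigID (fun T : {set I} => i \in T)) /= addrC.
congr (_ + _).
  apply: eq_bigl => T; apply/andP/idP => [[/subsetP sT iT]|sT].
    apply/subsetP => x xT; have := sT x xT; rewrite !inE.
    by case: eqP => // xi; rewrite -xi xT in iT.
  split; first exact: subset_trans sT (subsetUr _ _).
  by apply: contra iS => iT; exact: (subsetP sT).
rewrite (reindex_onto (fun T : {set I} => i |: T) (fun T => T :\ i)) /=; last first.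
  by move=> T /andP[_ iT]; rewrite setD1K.
apply: eq_bigl => T; apply/andP/idP => [[/andP[sT _] /eqP e]|sT].
  by rewrite -e subDset.
have iT : i \notin T by apply: contra iS => iT; exact: (subsetP sT).
by rewrite setU1K // eqxx setU11 setUS.
Qed.

(** Strong induction on [#|A|]: the proper subsets of A cancel. Identities between deviations can
    thus be checked in summed form, where no signs occur. *)
Lemma moebius_unique (I : finType) (E D : {set I} -> V) :
  (forall A : {set I}, \sum_(S : {set I} | S \subset A) E S = \sum_(S : {set I} | S \subset A) D S) ->
  E =1 D.
Proof.
move=> ED A; have [n] := ubnP #|A|; elim: n A => // n IH A; rewrite ltnS => An.
have := ED A; rewrite (bigD1 A) //= [RHS](bigD1 A) //=.
rewrite (eq_bigr D) => [/addIr//|S /andP[SA SnA]]; apply: IH.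
by apply: leq_trans An; apply: proper_card; rewrite properEneq SnA.
Qed.

Lemma moebius_unique2 (I J : finType) (E D : {set I} -> {set J} -> V) :
  (forall (A : {set I}) (A' : {set J}),
     \sum_(S : {set I} | S \subset A) \sum_(S' : {set J} | S' \subset A') E S S'
     = \sum_(S : {set I} | S \subset A) \sum_(S' : {set J} | S' \subset A') D S S') ->
  forall A A', E A A' = D A A'.
Proof.
move=> ED A A'; apply: (moebius_unique (E := E A) (D := D A)) => {}A'.
move: A; apply: moebius_unique => A; exact: ED.
Qed.

(** Recursion on the list needs no index set and parallels the recursion of [dev]; repeated entries
    are chosen independently. *)
Fixpoint sumsub (T : Type) (K : seq T -> V) (s : seq T) : V :=
  if s is x :: s' then sumsub K s' + sumsub (fun u => K (x :: u)) s' else K [::].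

Lemma eq_sumsub (T : Type) (K K' : seq T -> V) (s : seq T) :
  K =1 K' -> sumsub K s = sumsub K' s.
Proof.
elim: s K K' => [|x s IH] K K' KK' //=.
by rewrite (IH _ _ KK'); congr (_ + _); apply: IH => u; exact: KK'.
Qed.

Lemma sumsubD (T : Type) (K K' : seq T -> V) (s : seq T) :
  sumsub (fun u => K u + K' u) s = sumsub K s + sumsub K' s.
Proof. by elim: s K K' => [|x s IH] K K' //=; rewrite 2!IH addrACA. Qed.

Lemma sumsubN (T : Type) (K : seq T -> V) (s : seq T) :
  sumsub (fun u => - K u) s = - sumsub K s.
Proof. by elim: s K => [|x s IH] K //=; rewrite 2!IH opprD. Qed.

Definition perm_invariant (T : eqType) (V' : Type) (K : seq T -> V') :=
  forall s s', perm_eq s s' -> K s = K s'.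

Lemma perm_invariant_cons (T : eqType) (K : seq T -> V) x :
  perm_invariant K -> perm_invariant (fun u => K (x :: u)).
Proof. by move=> Kp s s' ss'; apply: Kp; rewrite perm_cons. Qed.

Lemma sumsub_swap (T : eqType) (K : seq T -> V) x y s :
  perm_invariant K -> sumsub K [:: x, y & s] = sumsub K [:: y, x & s].
Proof.
move=> Kp /=; rewrite addrACA; congr (_ + (_ + _)); apply: eq_sumsub => u.
exact/Kp/perm_swap.
Qed.

Lemma sumsub_perm (T : eqType) (K : seq T -> V) :
  perm_invariant K -> perm_invariant (sumsub K).
Proof.
move=> Kp s s'; elim: s s' K Kp => [|x s IH] s' K Kp.
  by rewrite perm_sym => /perm_nilP ->.
move=> ss'; have xs' : x \in s' by rewrite -(perm_mem ss') mem_head.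
(* Adjacent transpositions carry x to the head, after which the tails can be compared. *)
have move_front : sumsub K s' = sumsub K (x :: rem x s').
  elim: s' xs' K Kp {ss'} => // y s' IH' + K Kp; rewrite inE /= eq_sym.
  case: eqVneq => [-> //|yx] /= xs'.
  rewrite (IH' xs' _ Kp) (IH' xs' _ (perm_invariant_cons y Kp)).
  exact: (sumsub_swap y x (rem x s') Kp).
rewrite move_front /=.
have ss : perm_eq s (rem x s').
  by rewrite -(perm_cons x) (perm_trans ss') // perm_to_rem.
by rewrite (IH _ _ Kp ss) (IH _ _ (perm_invariant_cons x Kp) ss).
Qed.

Lemma sumsub_enum (I : finType) (T : eqType) (K : seq T -> V) (p : I -> T) (A : {set I}) :
  perm_invariant K ->
  sumsub K (map p (enum A)) = \sum_(S : {set I} | S \subset A) K (map p (enum S)).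
Proof.
have [n] := ubnP #|A|; elim: n A K => // n IH A K; rewrite ltnS => An Kp.
have [->|[i iA]] := set_0Vmem A.
  rewrite enum_set0 /= (big_pred1 set0) ?enum_set0 // => S.
  by rewrite subset0.
have iA' : i \notin A :\ i by rewrite !inE eqxx.
rewrite -(setD1K iA) sum_subsetU1 // big_split /=.
rewrite (sumsub_perm Kp (perm_map p (perm_enum_setU1 iA'))) /=.
have lt : (#|A :\ i| < n)%N by rewrite (leq_trans _ An) // [in X in (_ < X)%N](cardsD1 i) iA.
rewrite !IH //; last exact: perm_invariant_cons.
congr (_ + _); apply: eq_bigr => S SA; apply: Kp.
rewrite perm_sym -map_cons; apply/perm_map/perm_enum_setU1.
by apply: contra iA'; exact: (subsetP SA).
Qed.

End SubsetSums.

(* [dev f [:: a1; ...; ak] h] is the image under the linear extension of [f] of the element [h] * ([a1] - 1) * ... * ([ak] - 1) of the group ring of the additive group V. *)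
Section Deviations.
Variables (V W : zmodType).

Fixpoint dev (f : V -> W) (s : seq V) (h : V) : W :=
  if s is a :: s' then dev f s' (h + a) - dev f s' h else f h.

Definition dv f s := dev f s 0.

Variable f : V -> W.

Lemma dev_swap a b s h : dev f [:: a, b & s] h = dev f [:: b, a & s] h.
Proof.
rewrite /= (addrAC h b a) !opprB; set x := dev f s _; set z := dev f s h.
by rewrite 2![_ + (z - _)]addrACA [- _ - _]addrC.
Qed.

Lemma dev_perm s s' h : perm_eq s s' -> dev f s h = dev f s' h.
Proof.
elim: s s' h => [|x s IH] s' h; first by rewrite perm_sym => /perm_nilP ->.
move=> ss'; have xs' : x \in s' by rewrite -(perm_mem ss') mem_head.
have move_front : dev f s' h = dev f (x :: rem x s') h.
  elim: s' xs' h {ss'} => // y s' IH' + h; rewrite inE /= eq_sym.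
  case: eqVneq => [-> //|yx] /= xs'.
  rewrite (IH' xs' h) (IH' xs' (h + y)); exact: (dev_swap y x (rem x s') h).
rewrite move_front /=.
have ss : perm_eq s (rem x s').
  by rewrite -(perm_cons x) (perm_trans ss') // perm_to_rem.
by rewrite !(IH _ _ ss).
Qed.

Lemma dv_perm : perm_invariant (dv f).
Proof. by move=> s s'; exact: dev_perm. Qed.

(** The factor [0] - 1 is zero in the group ring: the source of relation (I). *)
Lemma dv_has0 s : 0 \in s -> dv f s = 0.
Proof. by move/perm_to_rem/dv_perm ->; rewrite /dv /= addr0 subrr. Qed.

(** The identity [a+b] - 1 = ([a] - 1) + ([b] - 1) + ([a] - 1)([b] - 1): the source of relation
    (II). *)
Lemma dv_addl a b s :
  dv f (a + b :: s) = dv f (a :: s) + dv f (b :: s) + dv f [:: a, b & s].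
Proof.
rewrite /dv /= !add0r; set t := dev f s 0.
by rewrite [RHS]addrC (addrC (_ - t)) subrKA subrKA.
Qed.

(** Expand the product of the factors [a] = 1 + ([a] - 1). *)
Lemma sumsub_dev s h : sumsub (fun u => dev f u h) s = f (h + \sum_(a <- s) a).
Proof.
elim: s h => [|a s IH] h; first by rewrite big_nil addr0.
by rewrite /= -sumsubD big_cons addrA -IH; apply: eq_sumsub => u /=; rewrite [LHS]addrC subrK.
Qed.

(** The opposite expansion, of the factors [a] + (-1). It ties the recursive [dev] to the signed sum
    that defines [dia]. *)
Lemma dev_sumsub s h :
  dev f s h = sumsub (fun u => let v := f (h + \sum_(a <- u) a) in
                               if odd (size s + size u) then - v else v) s.
Proof.
elim: s h => [|a s IH] h; first by rewrite /= big_nil addr0.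
rewrite /= 2!IH addrC -sumsubN; congr (_ + _); apply: eq_sumsub => u /=.
  by case: odd; rewrite ?opprK.
by rewrite addnS /= negbK big_cons addrA.
Qed.

End Deviations.

Section DeviationSums.
Variables (V W : zmodType) (f : V -> W).

Lemma fun_sum_dv (I : finType) (a : I -> V) (A : {set I}) :
  f (\sum_(i in A) a i) = \sum_(S : {set I} | S \subset A) dv f (map a (enum S)).
Proof.
rewrite -(sumsub_enum _ _ (dv_perm f)) /dv sumsub_dev add0r big_map.
by rewrite big_enum.
Qed.

Lemma fun_sum_dvT (I : finType) (a : I -> V) :
  f (\sum_i a i) = \sum_(S : {set I}) dv f (map a (enum S)).
Proof.
have -> : \sum_i a i = \sum_(i in setT) a i by apply: eq_bigl => i; rewrite inE.
by rewrite fun_sum_dv; apply: eq_bigl => S; rewrite subsetT.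
Qed.

Lemma dv_enum (I : finType) (a : I -> V) :
  dv f (map a (enum I)) =
  \sum_(S : {set I}) let v := f (\sum_(i in S) a i) in if odd (#|I| + #|S|) then - v else v.
Proof.
rewrite /dv dev_sumsub -[enum I](_ : enum [set: I] = _); last first.
  by apply: eq_enum => i; rewrite inE.
rewrite sumsub_enum => [|s s' ss']; last first.
  by rewrite (perm_size ss') (perm_big _ ss').
rewrite size_map -cardE cardsT; apply: eq_big => S; rewrite ?subsetT //= => _.
by rewrite add0r big_map big_enum size_map -cardE.
Qed.

End DeviationSums.

(** * Composition of multisets of passages *)

Section Crossings.
Variables (B : pzRingType) (X Y Z : finType).

Definition meets (p : Y * Z * B) (q : X * Y * B) : bool := p.1.1 == q.1.2.
Definition passage_comp (p : Y * Z * B) (q : X * Y * B) : X * Z * B :=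
  (q.1.1, p.1.2, p.2 * q.2).

Variable V : zmodType.
Variable K : seq (X * Z * B) -> V.

Section Indexed.
Variables (I J : finType) (p : I -> Y * Z * B) (q : J -> X * Y * B).

(* [U] is a sub-multiset of the compatible pairs of (p_i)_(i in A1) and (q_j)_(j in A2) in which every passage of both families occurs. *)
Definition crossing (A1 : {set I}) (A2 : {set J}) (U : {set I * J}) : bool :=
  [&& [forall u in U, meets (p u.1) (q u.2)], fst @: U == A1 & snd @: U == A2].

Definition crossing_sum (A1 : {set I}) (A2 : {set J}) : V :=
  \sum_(U | crossing A1 A2 U) K [seq passage_comp (p u.1) (q u.2) | u <- enum U].

End Indexed.

Hypothesis Kperm : perm_invariant K.

Lemma crossing_sum_imset (I I' J J' : finType) (p : I -> Y * Z * B) (q : J -> X * Y * B)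
    (al : I' -> I) (be : J' -> J) (A1 : {set I'}) (A2 : {set J'}) :
  injective al -> injective be ->
  crossing_sum (p \o al) (q \o be) A1 A2 = crossing_sum p q (al @: A1) (be @: A2).
Proof.
move=> al_inj be_inj; pose h (u : I' * J') := (al u.1, be u.2).
have h_inj : injective h by move=> [x y] [x' y'] [/al_inj -> /be_inj ->].
(* The projections of a crossing lie in the images of [al] and [be], so it is the image under h of
   its preimage. *)
rewrite /crossing_sum [RHS](reindex_onto (fun U : {set I' * J'} => h @: U)
  (fun U => h @^-1: U)) /=; last first.
  move=> U /and3P[_ /eqP U1 /eqP U2]; apply/setP => -[i j].
  apply/imsetP/idP => [[u + ->]|ijU]; first by rewrite inE.
  have : i \in fst @: U by apply/imsetP; exists (i, j).
  have : j \in snd @: U by apply/imsetP; exists (i, j).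
  rewrite U1 U2 => /imsetP[j' _ jj'] /imsetP[i' _ ii'].
  by exists (i', j'); rewrite ?inE /h /= -?ii' -?jj'.
apply: eq_big => U.
  have -> : h @^-1: (h @: U) = U.
    by apply/setP => u; rewrite inE mem_imset.
  rewrite eqxx andbT /crossing -!imset_comp; congr [&& _, _ & _].
  - apply/'forall_implyP/'forall_implyP => H u.
      by case/imsetP => v vU ->; exact: H.
    by move=> uU; have := H (h u) (imset_f h uU).
  - have -> : (fst \o h) @: U = al @: (fst @: U) by rewrite -imset_comp.
    by rewrite (inj_eq (imset_inj al_inj)).
  - have -> : (snd \o h) @: U = be @: (snd @: U) by rewrite -imset_comp.
    by rewrite (inj_eq (imset_inj be_inj)).
move=> _; apply: Kperm.
rewrite perm_sym (perm_trans (perm_map _ (perm_enum_imset U h_inj))) //.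
by rewrite -map_comp.
Qed.

(** The two existence conditions of [mvalid] say that both projections of S are onto. *)
Lemma sum_mvalid (P : seq (Y * Z * B)) (Q : seq (X * Y * B)) :
  \sum_(S : {set 'I_(size P) * 'I_(size Q)} | mvalid S) K (Umaze S) =
  crossing_sum (tnth (in_tuple P)) (tnth (in_tuple Q)) setT setT.
Proof.
apply: eq_bigl => S; congr [&& _, _ & _].
  apply/forallP/eqP => [H|H i].
    apply/setP => i; rewrite inE; have /existsP[j ij] := H i.
    by apply/imsetP; exists (i, j).
  have : i \in fst @: S by rewrite H.
  by case/imsetP => -[i' j] ij ->; apply/existsP; exists j.
apply/forallP/eqP => [H|H j].
  apply/setP => j; rewrite inE; have /existsP[i ij] := H j.
  by apply/imsetP; exists (i, j).
have : j \in snd @: S by rewrite H.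
by case/imsetP => -[i j'] ij ->; apply/existsP; exists i.
Qed.

Lemma enum_index (T : Type) (I : finType) (p : I -> T) (A : {set I}) :
  exists al : 'I_(size (map p (enum A))) -> I,
    [/\ injective al, al @: setT = A & tnth (in_tuple (map p (enum A))) =1 p \o al].
Proof.
have sz : size (map p (enum A)) = #|A| by rewrite size_map -cardE.
exists (fun i => enum_val (cast_ord sz i)); split.
- by move=> i j /enum_val_inj /cast_ord_inj.
- apply/setP => x; apply/imsetP/idP => [[i _ ->]|xA]; first exact: enum_valP.
  by exists (cast_ord (esym sz) (enum_rank_in xA x)); rewrite ?cast_ordKV ?enum_rankK_in.
- move=> i; have x := enum_val (cast_ord sz i).
  rewrite (tnth_nth (p x)) /= (nth_map x) ?(enum_val_nth x) //.
  by rewrite -cardE -sz.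
Qed.

(** Trades list positions for indices of a family, so that A1 and A2 may vary. *)
Lemma sum_mvalid_enum (I J : finType) (p : I -> Y * Z * B) (q : J -> X * Y * B)
    (A1 : {set I}) (A2 : {set J}) P Q :
  P = map p (enum A1) -> Q = map q (enum A2) ->
  \sum_(S : {set 'I_(size P) * 'I_(size Q)} | mvalid S) K (Umaze S) = crossing_sum p q A1 A2.
Proof.
move=> -> ->; rewrite sum_mvalid.
have [al [al_inj alT alE]] := enum_index p A1.
have [be [be_inj beT beE]] := enum_index q A2.
rewrite -[in RHS]alT -[in RHS]beT -crossing_sum_imset //.
apply: eq_big => U; first by congr (_ && _); apply: eq_forallb => u; rewrite alE beE.
by move=> _; congr K; apply: eq_map => u; rewrite alE beE.
Qed.

(** The compatible pairs form the graph of [phi]. A crossing has to cover A2, hence is the whole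
    graph over A2, and this covers exactly A1 only if [phi @: A2] is A1. *)
Lemma crossing_sum_graphL (I J : finType) (p : I -> Y * Z * B) (q : J -> X * Y * B)
    (phi : J -> I) (A1 : {set I}) (A2 : {set J}) :
  (forall i j, meets (p i) (q j) = (i == phi j)) ->
  crossing_sum p q A1 A2 =
  if phi @: A2 == A1 then K [seq passage_comp (p (phi j)) (q j) | j <- enum A2] else 0.
Proof.
move=> pqE; pose g j := (phi j, j).
have g_inj : injective g by move=> j j' [].
have crossE U : crossing p q A1 A2 U = (U == g @: A2) && (phi @: A2 == A1).
  apply/and3P/andP => [[/'forall_implyP H /eqP <- /eqP <-]|[/eqP -> /eqP <-]].
    have E u : u \in U -> u = g u.2.
      by case: u => i j /H; rewrite pqE /= => /eqP ->.
    rewrite -!imset_comp; split; apply/eqP.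
      by rewrite -[LHS]imset_id; apply: eq_in_imset => u /E.
    by apply: eq_in_imset => u /E {2}->.
  split; last 2 first.
  - by rewrite -imset_comp.
  - by rewrite -imset_comp (eq_imset _ (g := id)) // imset_id.
  by apply/'forall_implyP => u /imsetP[j _ ->]; rewrite pqE.
rewrite /crossing_sum (eq_bigl _ _ crossE); case: eqP => _; last first.
  by rewrite big_pred0 // => U; rewrite andbF.
rewrite (big_pred1 (g @: A2)) => [|U]; last by rewrite andbT.
apply: Kperm; rewrite (perm_trans (perm_map _ (perm_enum_imset A2 g_inj))) //.
by rewrite -map_comp.
Qed.

Lemma crossing_sum_graphR (I J : finType) (p : I -> Y * Z * B) (q : J -> X * Y * B)
    (phi : I -> J) (A1 : {set I}) (A2 : {set J}) :
  (forall i j, meets (p i) (q j) = (j == phi i)) ->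
  crossing_sum p q A1 A2 =
  if phi @: A1 == A2 then K [seq passage_comp (p i) (q (phi i)) | i <- enum A1] else 0.
Proof.
move=> pqE; pose g i := (i, phi i).
have g_inj : injective g by move=> i i' [].
have crossE U : crossing p q A1 A2 U = (U == g @: A1) && (phi @: A1 == A2).
  apply/and3P/andP => [[/'forall_implyP H /eqP <- /eqP <-]|[/eqP -> /eqP <-]].
    have E u : u \in U -> u = g u.1.
      by case: u => i j /H; rewrite pqE /= => /eqP ->.
    rewrite -!imset_comp; split; apply/eqP.
      by rewrite -[LHS]imset_id; apply: eq_in_imset => u /E.
    by apply: eq_in_imset => u /E {2}->.
  split; last 2 first.
  - by rewrite -imset_comp (eq_imset _ (g := id)) // imset_id.
  - by rewrite -imset_comp.
  by apply/'forall_implyP => u /imsetP[i _ ->]; rewrite pqE.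
rewrite /crossing_sum (eq_bigl _ _ crossE); case: eqP => _; last first.
  by rewrite big_pred0 // => U; rewrite andbF.
rewrite (big_pred1 (g @: A1)) => [|U]; last by rewrite andbT.
apply: Kperm; rewrite (perm_trans (perm_map _ (perm_enum_imset A1 g_inj))) //.
by rewrite -map_comp.
Qed.

End Crossings.

(** * Sources, targets and composition with passages labelled 1 *)

Section Relabelling.
Variable B : pzRingType.

Definition relabel (X X' Y Y' : Type) (f : X -> X') (g : Y -> Y') (P : seq (X * Y * B)) :
  seq (X' * Y' * B) := [seq (f p.1.1, g p.1.2, p.2) | p <- P].

(** Composition with these moves endpoints. With [id] on both sides, the deviation along them is the
    idempotent of F(B^X) that cuts out the summand of T. *)
Definition lines (W : finType) (X Y : Type) (f : W -> X) (g : W -> Y) (T : {set W}) :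
  seq (X * Y * B) := [seq (f w, g w, 1) | w <- enum T].

Definition sources (X Y : finType) (P : seq (X * Y * B)) : {set X} :=
  [set x | has (fun p => p.1.1 == x) P].
Definition targets (X Y : finType) (P : seq (X * Y * B)) : {set Y} :=
  [set y | has (fun p => p.1.2 == y) P].

Lemma is_mazeE (X Y : finType) (P : seq (X * Y * B)) :
  is_maze P <-> sources P = setT /\ targets P = setT.
Proof.
split=> [[Px Py]|[Px Py]].
  by split; apply/setP => z; rewrite !inE ?Px ?Py.
by split=> z; [move/setP/(_ z): Px|move/setP/(_ z): Py]; rewrite !inE.
Qed.

Lemma perm_sources (X Y : finType) (P P' : seq (X * Y * B)) :
  perm_eq P P' -> sources P = sources P'.
Proof. by move=> PP'; apply/setP => z; rewrite !inE (perm_has _ PP'). Qed.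

Lemma perm_targets (X Y : finType) (P P' : seq (X * Y * B)) :
  perm_eq P P' -> targets P = targets P'.
Proof. by move=> PP'; apply/setP => z; rewrite !inE (perm_has _ PP'). Qed.

Lemma sources_enum (X Y I : finType) (p : I -> X * Y * B) (A : {set I}) :
  sources (map p (enum A)) = [set (p i).1.1 | i in A].
Proof.
apply/setP => z; rewrite inE has_map; apply/hasP/imsetP => -[i iA /=].
  by rewrite mem_enum in iA => /eqP <-; exists i.
by move=> ->; exists i; rewrite ?mem_enum.
Qed.

Lemma targets_enum (X Y I : finType) (p : I -> X * Y * B) (A : {set I}) :
  targets (map p (enum A)) = [set (p i).1.2 | i in A].
Proof.
apply/setP => z; rewrite inE has_map; apply/hasP/imsetP => -[i iA /=].
  by rewrite mem_enum in iA => /eqP <-; exists i.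
by move=> ->; exists i; rewrite ?mem_enum.
Qed.

Lemma sources_relabel (X X' Y Y' : finType) (f : X -> X') (g : Y -> Y') (P : seq (X * Y * B)) :
  sources (relabel f g P) = f @: sources P.
Proof.
apply/setP => z; rewrite inE has_map; apply/hasP/imsetP => [[p pP /= /eqP <-]|[x]].
  by exists p.1.1 => //; rewrite inE; apply/hasP; exists p.
by rewrite inE => /hasP[p pP /eqP <-] ->; exists p => /=.
Qed.

Lemma targets_relabel (X X' Y Y' : finType) (f : X -> X') (g : Y -> Y') (P : seq (X * Y * B)) :
  targets (relabel f g P) = g @: targets P.
Proof.
apply/setP => z; rewrite inE has_map; apply/hasP/imsetP => [[p pP /= /eqP <-]|[x]].
  by exists p.1.2 => //; rewrite inE; apply/hasP; exists p.
by rewrite inE => /hasP[p pP /eqP <-] ->; exists p => /=.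
Qed.

Lemma relabel_comp (X X' X'' Y Y' Y'' : Type) (f : X -> X') (f' : X' -> X'') (g : Y -> Y')
    (g' : Y' -> Y'') (P : seq (X * Y * B)) :
  relabel f' g' (relabel f g P) = relabel (f' \o f) (g' \o g) P.
Proof. by rewrite /relabel -map_comp. Qed.

Lemma relabel_id (X Y : Type) (P : seq (X * Y * B)) : relabel id id P = P.
Proof. by rewrite /relabel -[RHS]map_id; apply: eq_map => -[[]]. Qed.

Lemma map_tnth_setT (T : Type) (P : seq T) :
  P = map (tnth (in_tuple P)) (enum [set: 'I_(size P)]).
Proof.
have -> : enum [set: 'I_(size P)] = enum 'I_(size P) by apply: eq_enum => i; rewrite inE.
by rewrite map_tnth_enum.
Qed.

Lemma mazeI_lines (X : finType) : mazeI B X = lines id id setT.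
Proof.
rewrite /mazeI /lines; have -> // : enum [set: X] = enum X.
by apply: eq_enum => x; rewrite inE.
Qed.

Lemma mazeI_maze (X : finType) : is_maze (mazeI B X).
Proof.
apply/is_mazeE; rewrite mazeI_lines sources_enum targets_enum /=.
by rewrite imset_id.
Qed.

Section CompositionWithLines.
Variables (X Y Z W : finType) (V : zmodType) (K : seq (X * Z * B) -> V).
Hypothesis Kperm : perm_invariant K.

(** Injectivity of s leaves each passage of Q a single line to meet, the one at its own target. *)
Lemma sum_mvalid_linesL (s : W -> Y) (g : W -> Z) (T : {set W}) (Q : seq (X * W * B))
    (P1 := lines s g T) (Q1 := relabel id s Q) :
  injective s ->
  \sum_(S : {set 'I_(size P1) * 'I_(size Q1)} | mvalid S) K (Umaze S) =
  if targets Q == T then K (relabel id g Q) else 0.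
Proof.
move=> s_inj; pose q j := let q := tnth (in_tuple Q) j in (q.1.1, s q.1.2, q.2).
have Q1E : Q1 = map q (enum setT).
  by rewrite /Q1 [in LHS](map_tnth_setT Q) /relabel -map_comp.
rewrite (sum_mvalid_enum Kperm (p := fun w => (s w, g w, 1)) (A1 := T) (erefl _) Q1E).
rewrite (crossing_sum_graphL Kperm (phi := fun j => (tnth (in_tuple Q) j).1.2)); last first.
  by move=> w j; rewrite /meets /= (inj_eq s_inj).
rewrite [in RHS](map_tnth_setT Q) targets_enum; case: eqP => // _; congr K.
by rewrite /relabel -map_comp; apply: eq_map => j; rewrite /passage_comp /= mul1r.
Qed.

Lemma sum_mvalid_linesR (s : W -> Y) (h : W -> X) (S : {set W}) (P : seq (W * Z * B))
    (P1 := relabel s id P) (Q1 := lines h s S) :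
  injective s ->
  \sum_(U : {set 'I_(size P1) * 'I_(size Q1)} | mvalid U) K (Umaze U) =
  if sources P == S then K (relabel h id P) else 0.
Proof.
move=> s_inj; pose p j := let p := tnth (in_tuple P) j in (s p.1.1, p.1.2, p.2).
have P1E : P1 = map p (enum setT).
  by rewrite /P1 [in LHS](map_tnth_setT P) /relabel -map_comp.
rewrite (sum_mvalid_enum Kperm (q := fun w => (h w, s w, 1)) (A2 := S) P1E (erefl _)).
rewrite (crossing_sum_graphR Kperm (phi := fun j => (tnth (in_tuple P) j).1.1)); last first.
  by move=> w j; rewrite /meets /= eq_sym (inj_eq s_inj).
rewrite [in RHS](map_tnth_setT P) sources_enum; case: eqP => // _; congr K.
by rewrite /relabel -map_comp; apply: eq_map => j; rewrite /passage_comp /= mulr1.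
Qed.

End CompositionWithLines.

End Relabelling.

(** * Additive structure on modules and homomorphisms *)

Section RmodZmodule.
Variables (B : pzRingType) (M : rmod B).
HB.instance Definition _ := gen_eqMixin (mcar M).
HB.instance Definition _ := gen_choiceMixin (mcar M).
HB.instance Definition _ := GRing.isZmodule.Build (mcar M)
  (@maddA B M) (@maddC B M) (@madd0 B M) (@maddN B M).
End RmodZmodule.

Lemma mhom_ext (B : pzRingType) (M N : rmod B) (f g : mhom M N) : f =1 g -> f = g.
Proof.
case: f g => f fD fA [g gD gA] /= /funext fg; rewrite -{}fg in gD gA *.
by rewrite (Prop_irrelevance fD gD) (Prop_irrelevance fA gA).
Qed.

Section MhomZmodule.
Variables (B : pzRingType) (M N : rmod B).
Lemma haddA : associative (@hadd B M N).
Proof. by move=> f g h; apply: mhom_ext => x /=; apply: maddA. Qed.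
Lemma haddC : commutative (@hadd B M N).
Proof. by move=> f g; apply: mhom_ext => x /=; apply: maddC. Qed.
Lemma hadd0 : left_id (hzero M N) (@hadd B M N).
Proof. by move=> f; apply: mhom_ext => x /=; apply: madd0. Qed.
Lemma haddN : left_inverse (hzero M N) (@hopp B M N) (@hadd B M N).
Proof. by move=> f; apply: mhom_ext => x /=; apply: maddN. Qed.
HB.instance Definition _ := gen_eqMixin (mhom M N).
HB.instance Definition _ := gen_choiceMixin (mhom M N).
HB.instance Definition _ := GRing.isZmodule.Build (mhom M N) haddA haddC hadd0 haddN.
End MhomZmodule.

Notation "g \oc f" := (hcomp g f) (at level 40, left associativity).

Section MhomAlgebra.
Variable B : pzRingType.
Implicit Types M N P Q : rmod B.

Lemma hfun_sum M N (f : mhom M N) I (r : seq I) (Pr : pred I) (F : I -> M) :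
  f (\sum_(i <- r | Pr i) F i) = \sum_(i <- r | Pr i) f (F i).
Proof. by apply: (big_morph f (hfunD f)); apply: add_fun0; apply: hfunD. Qed.

Lemma sum_hfun M N I (r : seq I) (Pr : pred I) (F : I -> mhom M N) x :
  (\sum_(i <- r | Pr i) F i : mhom M N) x = \sum_(i <- r | Pr i) F i x.
Proof. by apply: (big_morph (fun f : mhom M N => f x)). Qed.

Lemma hfun0 M N (f : mhom M N) : f 0 = 0.
Proof. exact: (add_fun0 (hfunD f)). Qed.

Lemma hcompA M N P Q (h : mhom P Q) (g : mhom N P) (f : mhom M N) :
  h \oc (g \oc f) = h \oc g \oc f.
Proof. exact: mhom_ext. Qed.

Lemma hcomp1l M N (f : mhom M N) : hid N \oc f = f.
Proof. exact: mhom_ext. Qed.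

Lemma hcomp1r M N (f : mhom M N) : f \oc hid M = f.
Proof. exact: mhom_ext. Qed.

Lemma hcompDl M N P (g g' : mhom N P) (f : mhom M N) : (g + g') \oc f = g \oc f + g' \oc f.
Proof. exact: mhom_ext. Qed.

Lemma hcompDr M N P (g : mhom N P) (f f' : mhom M N) : g \oc (f + f') = g \oc f + g \oc f'.
Proof. by apply: mhom_ext => x /=; apply: hfunD. Qed.

Lemma hcomp0l M N P (f : mhom M N) : (0 : mhom N P) \oc f = 0.
Proof. exact: mhom_ext. Qed.

Lemma hcomp0r M N P (g : mhom N P) : g \oc (0 : mhom M N) = 0.
Proof. by apply: mhom_ext => x /=; apply: hfun0. Qed.

Lemma hcompNr M N P (g : mhom N P) (f : mhom M N) : g \oc (- f) = - (g \oc f).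
Proof. by apply: mhom_ext => x /=; apply: (add_funN (hfunD g)). Qed.

Lemma hcomp_suml M N P (f : mhom M N) I (r : seq I) (Pr : pred I) (F : I -> mhom N P) :
  (\sum_(i <- r | Pr i) F i) \oc f = \sum_(i <- r | Pr i) F i \oc f.
Proof. by apply: (big_morph (fun g => g \oc f)) => [g g'|]; [apply: hcompDl|apply: hcomp0l]. Qed.

Lemma hcomp_sumr M N P (g : mhom N P) I (r : seq I) (Pr : pred I) (F : I -> mhom M N) :
  g \oc (\sum_(i <- r | Pr i) F i) = \sum_(i <- r | Pr i) g \oc F i.
Proof. by apply: (big_morph (fun f => g \oc f)) => [f f'|]; [apply: hcompDr|apply: hcomp0r]. Qed.

Lemma msumE M (T : Type) (s : seq T) (f : T -> M) : msum s f = \sum_(t <- s) f t.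
Proof. by elim: s => [|t s IH] /=; rewrite ?big_nil ?big_cons ?IH. Qed.

Lemma hsumLE M N (T : Type) (s : seq T) (a : T -> mhom M N) : hsumL s a = \sum_(t <- s) a t.
Proof. by elim: s => [|t s IH] /=; rewrite ?big_nil ?big_cons ?IH. Qed.

Lemma dia_dv (F : modfun B) (M N : xobj B) (I : finType) (a : I -> mhom M N) :
  dia F a = dv (@Fm B F M N) (map a (enum I)).
Proof.
rewrite dv_enum /dia hsumLE big_enum; apply: eq_bigr => S _ /=.
(* Since [#|S| <= #|I|], the truncated difference has the parity of the sum in [dv_enum]. *)
by rewrite /hsign oddB ?max_card // oddD hsumLE big_enum.
Qed.

End MhomAlgebra.

(** Aligns the expansion of a product of two sums, indexed by sets of pairs, with the product of
    their separate expansions. *)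
Lemma sum_proj_setX (V : zmodType) (I J : finType) (A1 : {set I}) (A2 : {set J})
    (G : {set I * J} -> V) :
  \sum_(U : {set I * J} | U \subset setX A1 A2) G U =
  \sum_(S : {set I} | S \subset A1) \sum_(S' : {set J} | S' \subset A2)
    \sum_(U : {set I * J} | (fst @: U == S) && (snd @: U == S')) G U.
Proof.
have subX (U : {set I * J}) :
    (U \subset setX A1 A2) = (fst @: U \subset A1) && (snd @: U \subset A2).
  apply/subsetP/andP => [UX|[/subsetP U1 /subsetP U2] u uU].
    by split; apply/subsetP => z /imsetP[u /UX + ->]; rewrite inE => /andP[].
  by rewrite inE U1 ?U2 //; apply: imset_f.
rewrite (partition_big (fun U : {set I * J} => fst @: U) (fun S => S \subset A1)) /=; last first.
  by move=> U; rewrite subX => /andP[].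
apply: eq_bigr => S S1.
rewrite (partition_big (fun U : {set I * J} => snd @: U) (fun S' => S' \subset A2)) /=; last first.
  by move=> U /andP[]; rewrite subX => /andP[].
apply: eq_bigr => S' S2; apply: eq_bigl => U; rewrite subX -andbA.
by case: (fst @: U =P S) => [->|]; case: (snd @: U =P S') => [->|]; rewrite ?andbF ?S1 ?S2.
Qed.

Lemma eq_dev (V W : zmodType) (f g : V -> W) s h : f =1 g -> dev f s h = dev g s h.
Proof. by move=> fg; elim: s h => [|a s IH] h //=; rewrite !IH. Qed.

Section HomDeviations.
Variables (B : pzRingType) (V : zmodType) (M N P : rmod B).

Lemma hcomp_dvr (g : mhom N P) (f : V -> mhom M N) s :
  g \oc dv f s = dv (fun a => g \oc f a) s.
Proof.
rewrite /dv; elim: s 0 => [|a s IH] h //=.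
by rewrite hcompDr hcompNr !IH.
Qed.

Lemma hcomp_dvl (g : mhom M N) (f : V -> mhom N P) s :
  dv f s \oc g = dv (fun a => f a \oc g) s.
Proof.
rewrite /dv; elim: s 0 => [|a s IH] h //=.
by rewrite hcompDl -!IH; apply: mhom_ext.
Qed.

End HomDeviations.

(** * Cross-effects *)

Section Passages.
Variable B : pzRingType.

Definition passage_hom (X Y : finType) (p : X * Y * B) : mhom (BX X) (BX Y) :=
  sigma p.1.1 p.1.2 p.2.

Lemma passage_hom_comp (X Y Z : finType) (p : Y * Z * B) (q : X * Y * B) :
  passage_hom p \oc passage_hom q = if meets p q then passage_hom (passage_comp p q) else 0.
Proof.
rewrite /meets; apply: mhom_ext => v; apply/funext => z /=.
case: (p.1.1 == q.1.2) => /=; case: (z == p.1.2); rewrite ?mulrA ?mulr0 //.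
Qed.

Lemma passage_hom0 (X Y : finType) (x : X) (y : Y) : passage_hom (x, y, 0) = 0.
Proof.
by apply: mhom_ext => v; apply/funext => z /=; case: ifP => // _; rewrite mul0r.
Qed.

Lemma passage_homD (X Y : finType) (x : X) (y : Y) a b :
  passage_hom (x, y, a + b) = passage_hom (x, y, a) + passage_hom (x, y, b).
Proof.
apply: mhom_ext => v; apply/funext => z /=; case: ifP => // _; last by rewrite addr0.
by rewrite mulrDl.
Qed.

End Passages.

Section MazeDeviations.
Variables (B : pzRingType) (F : modfun B).

Lemma Fm1 (M : xobj B) : Fm F (hid M) = hid (Fo F M).
Proof. by apply: mhom_ext => x; apply: Fm_id. Qed.

Lemma FmM (M N P : xobj B) (g : mhom N P) (f : mhom M N) : Fm F (g \oc f) = Fm F g \oc Fm F f.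
Proof. by apply: mhom_ext => x; apply: Fm_comp. Qed.

(** Taken for every multi-set of passages, maze or not, so that expansions over subsets and the
    composition law carry no side conditions. *)
Definition mdv (X Y : finType) (P : seq (X * Y * B)) : mhom (Fo F (BX X)) (Fo F (BX Y)) :=
  dv (@Fm B F (BX X) (BX Y)) (map (@passage_hom B X Y) P).

Lemma mdv_perm X Y : perm_invariant (@mdv X Y).
Proof. by move=> P P' PP'; apply/dv_perm/perm_map. Qed.

Lemma dia_mazehoms (X Y : finType) (P : seq (X * Y * B)) : dia F (mazehoms P) = mdv P.
Proof.
have E : P = map (tnth (in_tuple P)) (enum 'I_(size P)) by rewrite map_tnth_enum.
by rewrite dia_dv /mdv [in RHS]E -map_comp.
Qed.

Lemma dia_piX (X : finType) : dia F (@piX B X) = mdv (mazeI B X).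
Proof. by rewrite dia_dv /mdv /mazeI -[in RHS]map_comp. Qed.

Lemma mdv_comp_enum (X Y Z I J : finType) (p : I -> Y * Z * B) (q : J -> X * Y * B)
    (A1 : {set I}) (A2 : {set J}) :
  mdv (map p (enum A1)) \oc mdv (map q (enum A2)) = crossing_sum (@mdv X Z) p q A1 A2.
Proof.
pose E (A1 : {set I}) (A2 : {set J}) := mdv (map p (enum A1)) \oc mdv (map q (enum A2)).
(* Summed over all subsets of A1 and A2, the left side is a composite of two values of F, to which
   functoriality applies. *)
apply: (moebius_unique2 (E := E) (D := crossing_sum (@mdv X Z) p q)) => {}A1 {}A2; rewrite /E.
transitivity (Fm F (\sum_(i in A1) passage_hom (p i)) \oc Fm F (\sum_(j in A2) passage_hom (q j))).
  rewrite !fun_sum_dv hcomp_suml; apply: eq_bigr => S _.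
  by rewrite hcomp_sumr; apply: eq_bigr => S' _; rewrite /mdv -!map_comp.
pose G (u : I * J) := passage_hom (p u.1) \oc passage_hom (q u.2).
rewrite -FmM; have -> : (\sum_(i in A1) passage_hom (p i)) \oc
    (\sum_(j in A2) passage_hom (q j)) = \sum_(u in setX A1 A2) G u.
  rewrite hcomp_suml; under eq_bigr do rewrite hcomp_sumr.
  by rewrite pair_big /=; apply: eq_bigl => u; rewrite inE.
rewrite fun_sum_dv sum_proj_setX; apply: eq_bigr => S _; apply: eq_bigr => S' _.
(* Incompatible passages compose to 0, and a deviation with an entry 0 vanishes, so sets U
   containing such a pair drop out. *)
rewrite /crossing_sum (bigID (fun U : {set I * J} => [forall u in U, meets (p u.1) (q u.2)])) /=.
rewrite addrC big1 ?add0r => [|U /andP[_]]; last first.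
  rewrite negb_forall_in => /'exists_andP[u [uU nm]]; apply: dv_has0.
  apply/mapP; exists u; rewrite ?mem_enum // /G passage_hom_comp.
  by rewrite (negbTE nm).
apply: eq_big => [U|U /andP[_ /'forall_implyP m]]; first by rewrite andbC.
rewrite /mdv -map_comp; congr (dv _ _); apply/eq_in_map => u; rewrite mem_enum => uU.
by rewrite /G passage_hom_comp m.
Qed.

Lemma mdv_comp (X Y Z : finType) (P : seq (Y * Z * B)) (Q : seq (X * Y * B)) :
  mdv P \oc mdv Q = \sum_(S : {set 'I_(size P) * 'I_(size Q)} | mvalid S) mdv (Umaze S).
Proof.
by rewrite [in LHS](map_tnth_setT P) [in LHS](map_tnth_setT Q) mdv_comp_enum sum_mvalid.
Qed.

Lemma mdv_linesL (W X Y Z : finType) (s : W -> Y) (g : W -> Z) T (Q : seq (X * W * B)) :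
  injective s ->
  mdv (lines B s g T) \oc mdv (relabel id s Q) =
  if targets Q == T then mdv (relabel id g Q) else 0.
Proof. by move=> s_inj; rewrite mdv_comp (sum_mvalid_linesL (@mdv_perm _ _)). Qed.

Lemma mdv_linesR (W X Y Z : finType) (s : W -> Y) (h : W -> X) S (P : seq (W * Z * B)) :
  injective s ->
  mdv (relabel s id P) \oc mdv (lines B h s S) =
  if sources P == S then mdv (relabel h id P) else 0.
Proof. by move=> s_inj; rewrite mdv_comp (sum_mvalid_linesR (@mdv_perm _ _)). Qed.

(** Deviations along [lines B id id T] are orthogonal idempotents, and [mdv F P] lies in the single
    block given by its sources and targets. *)
Lemma mdv_idl (X Y : finType) (T : {set Y}) (P : seq (X * Y * B)) :
  mdv (lines B id id T) \oc mdv P = if targets P == T then mdv P else 0.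
Proof. by rewrite -{1}(relabel_id P) mdv_linesL ?relabel_id //; apply: inj_id. Qed.

Lemma mdv_idr (X Y : finType) (S : {set X}) (P : seq (X * Y * B)) :
  mdv P \oc mdv (lines B id id S) = if sources P == S then mdv P else 0.
Proof. by rewrite -{1}(relabel_id P) mdv_linesR ?relabel_id //; apply: inj_id. Qed.

Lemma mdv_mazeIl (X Y : finType) (P : seq (X * Y * B)) :
  targets P = setT -> mdv (mazeI B Y) \oc mdv P = mdv P.
Proof. by rewrite mazeI_lines mdv_idl => ->; rewrite eqxx. Qed.

Lemma mdv_mazeIr (X Y : finType) (P : seq (X * Y * B)) :
  sources P = setT -> mdv P \oc mdv (mazeI B X) = mdv P.
Proof. by rewrite mazeI_lines mdv_idr => ->; rewrite eqxx. Qed.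

Lemma mdv_crP (X Y : finType) (P : seq (X * Y * B)) v :
  targets P = setT -> crP F Y (mdv P v).
Proof. by move=> /mdv_mazeIl <-; exists (mdv P v); rewrite dia_piX. Qed.

Definition cr_incl (X : finType) : mhom (cr F X) (Fo F (BX X)) :=
  @MHom B (cr F X) (Fo F (BX X)) (fun v => sval v) (fun _ _ => erefl) (fun _ _ => erefl).

(** The deviation defining [cr] is idempotent; corestricted to its image, it splits the
    inclusion. *)
Definition cr_proj (X : finType) : mhom (Fo F (BX X)) (cr F X).
Proof.
refine (@MHom B (Fo F (BX X)) (cr F X)
  (fun x => exist _ (dia F (@piX B X) x) (ex_intro _ x erefl)) _ _) => *; apply: sig_eq => /=.
  exact: hfunD.
exact: hfunA.
Defined.

Lemma cr_inclK (X : finType) : cr_proj X \oc cr_incl X = hid (cr F X).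
Proof.
apply: mhom_ext => v; apply: sig_eq => /=; have [x ->] := proj2_sig v.
rewrite dia_piX -[LHS]/((mdv (mazeI B X) \oc mdv (mazeI B X)) x) mdv_mazeIl //.
by case/is_mazeE: (mazeI_maze B X).
Qed.

Lemma cr_projK (X : finType) : cr_incl X \oc cr_proj X = mdv (mazeI B X).
Proof. by apply: mhom_ext => x /=; rewrite dia_piX. Qed.

(** A homomorphism for every P, without the case distinction of [phiLm], with which it agrees on
    mazes. *)
Definition mazeM (X Y : finType) (P : seq (X * Y * B)) : mhom (cr F X) (cr F Y) :=
  cr_proj Y \oc mdv P \oc cr_incl X.

Lemma cr_incl_mazeM (X Y : finType) (P : seq (X * Y * B)) :
  targets P = setT -> cr_incl Y \oc mazeM P = mdv P \oc cr_incl X.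
Proof. by move=> PT; rewrite /mazeM !hcompA cr_projK mdv_mazeIl. Qed.

Lemma mazeM_cr_proj (X Y : finType) (P : seq (X * Y * B)) :
  sources P = setT -> mazeM P \oc cr_proj X = cr_proj Y \oc mdv P.
Proof. by move=> PS; rewrite /mazeM -!hcompA cr_projK mdv_mazeIr. Qed.

Lemma mazeM_comp (X Y Z : finType) (P : seq (Y * Z * B)) (Q : seq (X * Y * B)) :
  targets Q = setT ->
  mazeM P \oc mazeM Q =
  \sum_(S : {set 'I_(size P) * 'I_(size Q)} | mvalid S) mazeM (Umaze S).
Proof.
move=> QT; rewrite {1}/mazeM -!hcompA cr_incl_mazeM // !hcompA -[_ \oc mdv P \oc _]hcompA mdv_comp.
by rewrite hcomp_sumr hcomp_suml.
Qed.

Lemma phiLmE (X Y : finType) (P : seq (X * Y * B)) v :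
  is_maze P -> phiLm F P v = mazeM P v.
Proof.
case/is_mazeE => _ PT; rewrite /phiLm; case: excluded_middle_informative => [h|[]].
  apply: sig_eq; rewrite -[RHS]/((cr_incl Y \oc mazeM P) v) cr_incl_mazeM //=.
  by rewrite dia_mazehoms.
by rewrite dia_mazehoms; apply: mdv_crP.
Qed.

End MazeDeviations.

Lemma Umaze_maze (B : pzRingType) (X Y Z : finType) (P : seq (Y * Z * B)) (Q : seq (X * Y * B))
    (S : {set 'I_(size P) * 'I_(size Q)}) :
  is_maze P -> is_maze Q -> mvalid S -> is_maze (Umaze S).
Proof.
move=> [_ PZ] [QX _] /and3P[_ /forallP SP /forallP SQ].
split=> [x|z].
  have /hasP[q /seq_tnthP[j ->] qx] := QX x.
  have /existsP[i ij] := SQ j; rewrite has_map; apply/hasP; exists (i, j) => //.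
  by rewrite mem_enum.
have /hasP[q /seq_tnthP[i ->] qz] := PZ z.
have /existsP[j ij] := SP i; rewrite has_map; apply/hasP; exists (i, j) => //.
by rewrite mem_enum.
Qed.

Lemma maze_perm (B : pzRingType) (X Y : finType) (P P' : seq (X * Y * B)) :
  perm_eq P P' -> is_maze P -> is_maze P'.
Proof.
by move=> PP' /is_mazeE[? ?]; apply/is_mazeE; rewrite -(perm_sources PP') -(perm_targets PP').
Qed.

Lemma maze_relabel_last (B : pzRingType) (X Y : finType) (P : seq (X * Y * B)) x y a b :
  is_maze (rcons P (x, y, a)) -> is_maze (rcons P (x, y, b)).
Proof.
by move=> [PX PY]; split=> z; [move: (PX z)|move: (PY z)]; rewrite !has_rcons.
Qed.

Lemma maze_rcons (B : pzRingType) (X Y : finType) (P : seq (X * Y * B)) p :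
  is_maze P -> is_maze (rcons P p).
Proof.
by move=> [PX PY]; split=> z; rewrite has_rcons ?PX ?PY orbT.
Qed.

(** * Phi on functors and on natural transformations *)

Section PhiLaws.
Variables (B : pzRingType) (F : modfun B).

Lemma Phi_laws : linrep_laws (Phi F).
Proof.
split=> /=.
- by move=> X Y P mP u v; rewrite !phiLmE //; exact: (hfunD (mazeM F P) u v).
- by move=> X Y P mP u b; rewrite !phiLmE //; exact: (hfunA (mazeM F P) u b).
- move=> X Y P P' mP PP' v; rewrite !phiLmE //; last exact: maze_perm mP.
  by rewrite /mazeM (mdv_perm F PP').
- move=> X Y P x y mP v; rewrite !phiLmE // /mazeM.
  have -> : mdv F (rcons P (x, y, 0)) = 0.
    apply: dv_has0; rewrite map_rcons mem_rcons inE -(passage_hom0 B x y).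
    by rewrite eqxx.
  by rewrite hcomp0r hcomp0l.
- move=> X Y P x y a b mPa v; have mPb := maze_relabel_last b mPa.
  have mPab := maze_relabel_last (a + b) mPa; rewrite !phiLmE //; last exact: maze_rcons.
  (* Relation (II) appends passages at the end, while [dv_addl] splits the entry at the head. *)
  have rc (p : X * Y * B) P1 : mdv F (rcons P1 p) = mdv F (p :: P1).
    by apply: mdv_perm; rewrite perm_rcons.
  rewrite /mazeM !rc.
  have ba : perm_eq ((x, y, b) :: rcons P (x, y, a)) [:: (x, y, a), (x, y, b) & P].
    by rewrite -(cat1s _ (rcons _ _)) -cats1 catA perm_catC.
  rewrite (mdv_perm F ba).
  rewrite /mdv !map_cons passage_homD dv_addl !hcompDr !hcompDl.
  by [].
- move=> X Y Z P Q mP mQ v; rewrite (phiLmE _ mP) (phiLmE _ mQ).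
  rewrite -[LHS]/((mazeM F P \oc mazeM F Q) v) mazeM_comp; last by case/is_mazeE: mQ.
  rewrite msumE sum_hfun big_filter big_enum_cond /=; apply: eq_bigr => S mS.
  by rewrite phiLmE //; apply: Umaze_maze.
- move=> X v; rewrite phiLmE; last exact: mazeI_maze.
  by rewrite /mazeM -cr_projK hcompA cr_inclK hcomp1l cr_inclK.
Qed.

End PhiLaws.

Section NaturalTransformations.
Variables (B : pzRingType) (F G : modfun B).
Implicit Types z w : nattr F G.

Lemma ntc_nat z (M N : xobj B) (f : mhom M N) : ntc z N \oc Fm F f = Fm G f \oc ntc z M.
Proof. by apply: mhom_ext => x; apply: ntnat. Qed.

(** Composition is additive on both sides, so naturality passes from the values F(f) to their
    alternating sums. *)
Lemma ntc_mdv z (X Y : finType) (P : seq (X * Y * B)) :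
  ntc z (BX Y) \oc mdv F P = mdv G P \oc ntc z (BX X).
Proof.
rewrite hcomp_dvr hcomp_dvl; apply: eq_dev => f; exact: ntc_nat.
Qed.

Lemma ntc_crP z (X : finType) (v : cr F X) : crP G X (ntc z (BX X) (sval v)).
Proof.
have [x ->] := proj2_sig v; rewrite dia_piX -[ntc _ _ _]/((ntc z (BX X) \oc mdv F (mazeI B X)) x).
by rewrite ntc_mdv /=; apply: mdv_crP; case/is_mazeE: (mazeI_maze B X).
Qed.

Definition ntM z (X : finType) : mhom (cr F X) (cr G X) :=
  cr_proj G X \oc ntc z (BX X) \oc cr_incl F X.

Lemma cr_incl_ntM z (X : finType) : cr_incl G X \oc ntM z X = ntc z (BX X) \oc cr_incl F X.
Proof.
rewrite /ntM !hcompA cr_projK -ntc_mdv -hcompA -cr_projK.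
by rewrite -(hcompA (cr_incl F X)) cr_inclK hcomp1r.
Qed.

Lemma phi_ntE z (X : finType) v : phi_nt z v = ntM z X v.
Proof.
rewrite /phi_nt; case: excluded_middle_informative => [h|[]]; last exact: ntc_crP.
by apply: sig_eq; rewrite -[RHS]/((cr_incl G X \oc ntM z X) v) cr_incl_ntM.
Qed.

Lemma ntM_nat z (X Y : finType) (P : seq (X * Y * B)) :
  is_maze P -> ntM z Y \oc mazeM F P = mazeM G P \oc ntM z X.
Proof.
case/is_mazeE=> PX PY.
rewrite /ntM -[LHS]hcompA cr_incl_mazeM // !hcompA -(hcompA _ (ntc z _)) ntc_mdv.
by rewrite !hcompA mazeM_cr_proj.
Qed.

Lemma phi_nt_laws z : repmorph_laws (phi_nt z).
Proof.
split.
- by move=> X u v; rewrite !phi_ntE; exact: (hfunD (ntM z X) u v).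
- by move=> X u b; rewrite !phi_ntE; exact: (hfunA (ntM z X) u b).
- move=> X Y P mP v; rewrite /= !phiLmE // !phi_ntE.
  by rewrite -[LHS]/((ntM z Y \oc mazeM F P) v) ntM_nat.
Qed.

End NaturalTransformations.

(** * Coordinates and matrices *)

Section Bases.
Variable B : pzRingType.

Lemma free_basis_iso (M : xobj B) :
  exists (I : finType) (phi : mhom M (BX I)) (psi : mhom (BX I) M),
    psi \oc phi = hid M /\ phi \oc psi = hid (BX I).
Proof.
have [I [e [g gK Kg]]] := xfree M.
set h := (fun c : I -> B => msum _ _) in gK Kg.
have hD c d : h (madd (c : funmod I) d) = madd (h c) (h d).
  rewrite /h !msumE; rewrite -[RHS]big_split /=.
  by apply: eq_bigr => i _; apply: mactDr.
have hA c b : h (mact (c : funmod I) b) = mact (h c) b.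
  rewrite /h !msumE (big_morph (fun x : M => mact x b : M) (id1 := 0) (op1 := +%R)).
  - by apply: eq_bigr => i _; apply: mactM.
  - by move=> x y; apply: mactDl.
  - exact: mact0.
pose psi : mhom (BX I) M := @MHom B (BX I) M h hD hA.
have gD x y : g (madd x y) = madd (g x : funmod I) (g y).
  by apply: (can_inj gK); rewrite Kg hD !Kg.
have gA x b : g (mact x b) = mact (g x : funmod I) b.
  by apply: (can_inj gK); rewrite Kg hA !Kg.
exists I, (@MHom B M (BX I) g gD gA), psi.
by split; apply: mhom_ext => x /=; [apply: Kg|apply: gK].
Qed.

(** The basis chosen for [BX X] need not be X, so even there [coords] is merely some isomorphism. *)
Definition basis (M : xobj B) : finType := projT1 (cid (free_basis_iso M)).
Definition coords (M : xobj B) : mhom M (BX (basis M)) :=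
  projT1 (cid (projT2 (cid (free_basis_iso M)))).
Definition lincomb (M : xobj B) : mhom (BX (basis M)) M :=
  projT1 (cid (projT2 (cid (projT2 (cid (free_basis_iso M)))))).

Lemma coordsK (M : xobj B) : lincomb M \oc coords M = hid M.
Proof. by case: (projT2 (cid (projT2 (cid (projT2 (cid (free_basis_iso M))))))). Qed.

Lemma lincombK (M : xobj B) : coords M \oc lincomb M = hid (BX (basis M)).
Proof. by case: (projT2 (cid (projT2 (cid (projT2 (cid (free_basis_iso M))))))). Qed.

(** A matrix entry as a passage; entries 0 are kept, so that all maps share the index set X * Y. *)
Definition coef (X Y : finType) (f : mhom (BX X) (BX Y)) (u : X * Y) : X * Y * B :=
  (u.1, u.2, (f (ebasis B u.1) : funmod Y) u.2).

Lemma sum_eval (X I : finType) (Pr : pred I) (v : I -> @BX B X) y :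
  (\sum_(i | Pr i) v i : BX X) y = \sum_(i | Pr i) (v i : funmod X) y.
Proof. by apply: (big_morph (fun v : BX X => (v : funmod X) y)). Qed.

Lemma sum_ebasis (X : finType) (v : @BX B X) :
  v = \sum_x (mact (ebasis B x) (v x) : BX X).
Proof.
apply/funext => y; rewrite sum_eval (bigD1 y) //= /ebasis eqxx mul1r big1 ?addr0 //.
by move=> i; rewrite eq_sym => /negbTE ->; rewrite mul0r.
Qed.

Lemma sum_coef (X Y : finType) (f : mhom (BX X) (BX Y)) :
  f = \sum_u passage_hom (coef f u).
Proof.
apply: mhom_ext => v; apply/funext => y; rewrite [in LHS](sum_ebasis v) hfun_sum sum_hfun !sum_eval.
rewrite -(pair_big xpredT xpredT (fun x y' => (passage_hom (coef f (x, y')) v : funmod Y) y)) /=.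
apply: eq_bigr => x _; rewrite (bigD1 y) //= eqxx big1 ?addr0 ?hfunA // => y'.
by rewrite eq_sym => /negbTE ->.
Qed.

Lemma hid_passages (X : finType) : hid (BX X) = \sum_x passage_hom (x, x, 1 : B).
Proof.
apply: mhom_ext => v; apply/funext => y; rewrite sum_hfun sum_eval (bigD1 y) //=.
by rewrite eqxx mul1r big1 ?addr0 // => x; rewrite eq_sym => /negbTE ->.
Qed.

End Bases.

(** * Full faithfulness *)

Section Restriction.
Variables (B : pzRingType) (X Y : finType).

Definition restrict_passage (S : {set X}) (T : {set Y}) (p : X * Y * B) :
  option ({x | x \in S} * {y | y \in T} * B) :=
  if insub p.1.1 is Some x then
    if insub p.1.2 is Some y then Some (x, y, p.2) else None
  else None.

(** For S the sources and T the targets of P, this rereads P as a maze between finite types. *)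
Definition restrict (S : {set X}) (T : {set Y}) (P : seq (X * Y * B)) :
  seq ({x | x \in S} * {y | y \in T} * B) := pmap (restrict_passage S T) P.

Implicit Types (S : {set X}) (T : {set Y}) (P : seq (X * Y * B)).

Lemma perm_restrict S T P P' : perm_eq P P' -> perm_eq (restrict S T P) (restrict S T P').
Proof. exact: perm_pmap. Qed.

Lemma relabel_restrict S T P :
  sources P \subset S -> targets P \subset T -> relabel val val (restrict S T P) = P.
Proof.
move=> /subsetP PS /subsetP PT.
have {PS PT} : all (fun p => (p.1.1 \in S) && (p.1.2 \in T)) P.
  apply/allP => p pP; rewrite PS ?PT // inE; apply/hasP; by exists p.
elim: P => //= -[[x y] b] P IH /andP[/andP[/= xS yT] /IH {}IH].
rewrite /restrict /= /oapp /restrict_passage /= (insubT (mem S) xS) (insubT (mem T) yT) /=.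
by congr (_ :: _).
Qed.

Lemma val_sub_setT (W : finType) (S : {set W}) : [set val w | w in [set: {x | x \in S}]] = S.
Proof.
apply/setP => x; apply/imsetP/idP => [[w _ ->]|xS]; first exact: valP.
by exists (exist _ x xS).
Qed.

Lemma val_sub_eq (W : finType) (S : {set W}) (A : {set {x | x \in S}}) :
  val @: A = S -> A = setT.
Proof. by rewrite -[RHS]val_sub_setT => /(imset_inj val_inj). Qed.

Lemma restrict_maze P : is_maze (restrict (sources P) (targets P) P).
Proof.
apply/is_mazeE; split; apply: val_sub_eq; rewrite -?sources_relabel -?targets_relabel.
  by rewrite -(sources_relabel val val) relabel_restrict.
by rewrite -(targets_relabel val val) relabel_restrict.
Qed.

End Restriction.

Section Inclusions.
Variables (B : pzRingType).

(** Deviations along [sub_in S] and [sub_out S] embed the summand of S into F(B^X) and project onto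
    it; composed in F(B^X), they give its idempotent. *)
Definition sub_in (X : finType) (S : {set X}) : seq ({x | x \in S} * X * B) :=
  lines B id val setT.
Definition sub_out (X : finType) (S : {set X}) : seq (X * {x | x \in S} * B) :=
  lines B val id setT.

Lemma sources_sub_in (X : finType) (S : {set X}) : sources (sub_in S) = setT.
Proof. by rewrite sources_enum /= imset_id. Qed.
Lemma targets_sub_in (X : finType) (S : {set X}) : targets (sub_in S) = S.
Proof. by rewrite targets_enum /= val_sub_setT. Qed.
Lemma sources_sub_out (X : finType) (S : {set X}) : sources (sub_out S) = S.
Proof. by rewrite sources_enum /= val_sub_setT. Qed.
Lemma targets_sub_out (X : finType) (S : {set X}) : targets (sub_out S) = setT.
Proof. by rewrite targets_enum /= imset_id. Qed.

Variable F : modfun B.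

(** Both composites are the deviation along P with its sources read in S and its targets in Y. *)
Lemma mdv_sub_in_restrict (X Y : finType) (P : seq (X * Y * B)) (S := sources P)
    (T := targets P) :
  mdv F P \oc mdv F (sub_in S) = mdv F (sub_in T) \oc mdv F (restrict S T P).
Proof.
set P' := restrict S T P; have [P'S P'T] := (is_mazeE _).1 (restrict_maze P).
rewrite -{1}(relabel_restrict (subxx S) (subxx T)).
rewrite -[relabel _ _ _](relabel_comp id val val id).
rewrite mdv_linesR ?sources_relabel ?imset_id ?P'S ?eqxx; last exact: val_inj.
by rewrite relabel_comp -(relabel_id P') mdv_linesL ?P'T ?eqxx //; apply: inj_id.
Qed.

Lemma mdv_sub_out_restrict (X Y : finType) (P : seq (X * Y * B)) (S := sources P)
    (T := targets P) :
  mdv F (sub_out T) \oc mdv F P = mdv F (restrict S T P) \oc mdv F (sub_out S).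
Proof.
set P' := restrict S T P; have [P'S P'T] := (is_mazeE _).1 (restrict_maze P).
rewrite -{1}(relabel_restrict (subxx S) (subxx T)).
rewrite -[relabel _ _ _](relabel_comp val id id val).
rewrite mdv_linesL ?targets_relabel ?imset_id ?P'T ?eqxx; last exact: val_inj.
by rewrite relabel_comp -(relabel_id P') mdv_linesR ?P'S ?eqxx //; apply: inj_id.
Qed.

(** [sub_in S] absorbs the idempotent of S, which is killed by deviations with another source
    set. *)
Lemma mdv_sub_in_ne (X Y : finType) (P : seq (X * Y * B)) (S : {set X}) :
  S != sources P -> mdv F P \oc mdv F (sub_in S) = 0.
Proof.
move=> SP; have <- : mdv F (lines B id id S) \oc mdv F (sub_in S) = mdv F (sub_in S).
  by rewrite mdv_idl targets_sub_in eqxx.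
by rewrite hcompA mdv_idr eq_sym (negbTE SP) hcomp0l.
Qed.

Lemma mdv_sub_out_ne (X Y : finType) (P : seq (X * Y * B)) (T : {set Y}) :
  T != targets P -> mdv F (sub_out T) \oc mdv F P = 0.
Proof.
move=> TP; have <- : mdv F (sub_out T) \oc mdv F (lines B id id T) = mdv F (sub_out T).
  by rewrite mdv_idr sources_sub_out eqxx.
by rewrite -hcompA mdv_idl eq_sym (negbTE TP) hcomp0r.
Qed.

Lemma mdv_sub_in_out (X : finType) (S : {set X}) :
  mdv F (sub_in S) \oc mdv F (sub_out S) = mdv F (lines B id id S).
Proof.
have SE : perm_eq (enum S) (map val (enum [set: {x | x \in S}])).
  by rewrite -{1}(val_sub_setT S); apply: perm_enum_imset val_inj.
rewrite -(relabel_id (sub_out S)) mdv_linesL; last exact: inj_id.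
rewrite targets_sub_out eqxx; apply: mdv_perm; rewrite perm_sym (perm_trans (perm_map _ SE)) //.
by rewrite /relabel /sub_out /lines -!map_comp.
Qed.

Lemma hid_lines (X : finType) :
  hid (Fo F (BX X)) = \sum_(S : {set X}) mdv F (lines B id id S).
Proof.
rewrite -Fm1 hid_passages fun_sum_dvT; apply: eq_bigr => S _.
by rewrite /mdv /lines -map_comp.
Qed.

Lemma Fm_coef (X Y : finType) (f : mhom (BX X) (BX Y)) :
  Fm F f = \sum_(S : {set X * Y}) mdv F (map (coef f) (enum S)).
Proof.
rewrite {1}(sum_coef f) fun_sum_dvT; apply: eq_bigr => S _.
by rewrite /mdv -map_comp.
Qed.

End Inclusions.

Section Faithful.
Variables (B : pzRingType) (F G : modfun B) (z w : nattr F G).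

Lemma Phi_faithful : (forall (X : finType) (v : Lo (Phi F) X), phi_nt z v = phi_nt w v) ->
  forall (M : xobj B) (x : Fo F M), ntc z M x = ntc w M x.
Proof.
move=> zw M x; suff -> : ntc z M = ntc w M by [].
have {}zw X : ntM z X = ntM w X by apply: mhom_ext => v; rewrite -(phi_ntE z) -(phi_ntE w); apply: zw.
have BXE X : ntc z (BX X) = ntc w (BX X).
  (* On the summand of S, z is determined by its restriction to the cross-effect of the finite set
     S. *)
  rewrite -[LHS]hcomp1r -[RHS]hcomp1r hid_lines !hcomp_sumr; apply: eq_bigr => S _.
  rewrite -mdv_sub_in_out -(mdv_mazeIl F (targets_sub_out B S)) -cr_projK !hcompA !ntc_mdv.
  by rewrite -!(hcompA _ (ntc _ _)) -!cr_incl_ntM zw.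
rewrite -[ntc z M]hcomp1r -[ntc w M]hcomp1r -Fm1 -coordsK FmM !hcompA !ntc_nat.
by rewrite BXE.
Qed.

End Faithful.

Section Full.
Variables (B : pzRingType) (F G : modfun B).
Variable e : forall X : finType, Lo (Phi F) X -> Lo (Phi G) X.
Hypothesis eP : repmorph_laws e.

Definition mor_hom (X : finType) : mhom (cr F X) (cr G X) :=
  @MHom B (cr F X) (cr G X) (@e X) (@rm_add _ _ _ _ eP X) (@rm_act _ _ _ _ eP X).

Lemma mor_hom_nat (X Y : finType) (P : seq (X * Y * B)) :
  is_maze P -> mor_hom Y \oc mazeM F P = mazeM G P \oc mor_hom X.
Proof.
move=> mP; apply: mhom_ext => v; rewrite -[LHS]/(e (mazeM F P v)) -[RHS]/(mazeM G P (e v)).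
by rewrite -(phiLmE v mP) -(phiLmE (e v) mP); apply: (rm_nat eP).
Qed.

(** Block diagonal for the splitting of F(B^X), with block e at the finite set of elements of S. *)
Definition ext_BX (X : finType) : mhom (Fo F (BX X)) (Fo G (BX X)) :=
  \sum_(S : {set X}) mdv G (sub_in B S) \oc cr_incl G _ \oc mor_hom _ \oc cr_proj F _
     \oc mdv F (sub_out B S).

(** Only the blocks at [targets P] and [sources P] survive; between them P acts through its
    restriction, a maze, for which e is natural. *)
Lemma ext_BX_mdv (X Y : finType) (P : seq (X * Y * B)) :
  ext_BX Y \oc mdv F P = mdv G P \oc ext_BX X.
Proof.
rewrite /ext_BX hcomp_suml hcomp_sumr (bigD1 (targets P)) //= [RHS](bigD1 (sources P)) //=.
rewrite !big1 ?addr0.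
- have mP' := restrict_maze P; have [P'S P'T] := (is_mazeE _).1 mP'.
  rewrite -!hcompA mdv_sub_out_restrict !hcompA mdv_sub_in_restrict; congr (_ \oc _).
  rewrite -(hcompA _ (cr_proj F _)) -(mazeM_cr_proj F P'S).
  rewrite (hcompA _ (mazeM F _) (cr_proj F _)); congr (_ \oc _).
  rewrite -(hcompA _ (mor_hom _) (mazeM F _)) mor_hom_nat // (hcompA _ (mazeM G _)).
  congr (_ \oc _).
  by rewrite -(hcompA _ (cr_incl G _) (mazeM G _)) cr_incl_mazeM // hcompA.
- by move=> S SP; rewrite !hcompA mdv_sub_in_ne // !hcomp0l.
- by move=> T TP; rewrite -hcompA mdv_sub_out_ne // hcomp0r.
Qed.

Lemma ext_BX_nat (X Y : finType) (f : mhom (BX X) (BX Y)) :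
  ext_BX Y \oc Fm F f = Fm G f \oc ext_BX X.
Proof.
rewrite (Fm_coef F f) (Fm_coef G f) hcomp_sumr (hcomp_suml (ext_BX X)).
by apply: eq_bigr => S _; exact: ext_BX_mdv.
Qed.

Lemma ext_BX_cr (X : finType) : ext_BX X \oc cr_incl F X = cr_incl G X \oc mor_hom X.
Proof.
have inclE H : cr_incl H X = mdv H (mazeI B X) \oc cr_incl H X.
  by rewrite -cr_projK -hcompA cr_inclK hcomp1r.
rewrite /ext_BX hcomp_suml (bigD1 setT) //= big1 ?addr0 => [|S ST]; last first.
  rewrite -hcompA inclE mazeI_lines (hcompA (mdv F _)) mdv_sub_out_ne ?hcomp0l ?hcomp0r //.
  by rewrite targets_enum imset_id.
(* The block of [setT] is e at the type of elements of [setT], not at X; naturality along this maze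
   compares the two. *)
have mO : is_maze (sub_out B [set: X]).
  by apply/is_mazeE; rewrite sources_sub_out targets_sub_out.
have [OS OT] := (is_mazeE _).1 mO.
rewrite -2!hcompA (hcompA (cr_proj F _)) -/(mazeM F _) -hcompA mor_hom_nat //.
rewrite (hcompA _ (mazeM G _)) -(hcompA _ (cr_incl G _) (mazeM G _)) cr_incl_mazeM // !hcompA mdv_sub_in_out.
by rewrite -mazeI_lines -inclE.
Qed.

Definition ext_nt (M : xobj B) : mhom (Fo F M) (Fo G M) :=
  Fm G (lincomb M) \oc ext_BX (basis M) \oc Fm F (coords M).

Lemma ext_nt_nat (M N : xobj B) (f : mhom M N) : ext_nt N \oc Fm F f = Fm G f \oc ext_nt M.
Proof.
(* Passing f through the chosen coordinates of M and N leaves a map of standard modules, where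
   [ext_BX_nat] applies. *)
rewrite /ext_nt -{1}[f]hcomp1r -coordsK -!hcompA -!FmM !FmM.
rewrite (hcompA (Fm F (coords N))) -FmM (hcompA (Fm F _) (Fm F _)) -FmM.
rewrite (hcompA (ext_BX _)) ext_BX_nat !hcompA -!FmM !hcompA coordsK.
by rewrite hcomp1l FmM.
Qed.

Lemma ext_nt_BX (X : finType) : ext_nt (BX X) = ext_BX X.
Proof.
by rewrite /ext_nt -ext_BX_nat -hcompA -FmM coordsK Fm1 hcomp1r.
Qed.

Lemma Phi_full : exists z : nattr F G, forall (X : finType) (v : Lo (Phi F) X),
  phi_nt z v = e v.
Proof.
have nat (M N : xobj B) (f : mhom M N) x : ext_nt N (Fm F f x) = Fm G f (ext_nt M x).
  by rewrite -[LHS]/((ext_nt N \oc Fm F f) x) ext_nt_nat.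
exists (NatTr nat) => X v; rewrite phi_ntE; suff -> : ntM (NatTr nat) X = mor_hom X by [].
by rewrite /ntM [ntc _ _]ext_nt_BX -hcompA ext_BX_cr hcompA cr_inclK hcomp1l.
Qed.

End Full.

(** * Essential surjectivity *)

Section Products.
Variables (B : pzRingType) (I : Type) (M : I -> rmod B).

Definition prod_rmod : rmod B.
Proof.
refine (@RMod B (forall i, M i) (fun f g i => madd (f i) (g i)) (fun _ => mzero _)
  (fun f i => mopp (f i)) (fun f b i => mact (f i) b) _ _ _ _ _ _ _ _) => *;
  apply/functional_extensionality_dep => i.
- exact: maddA.
- exact: maddC.
- exact: madd0.
- exact: maddN.
- exact: mactDl.
- exact: mactDr.
- exact: mactM.
- exact: mact1.
Defined.

Definition prod_proj (i : I) : mhom prod_rmod (M i) :=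
  @MHom B prod_rmod (M i) (fun f => f i) (fun _ _ => erefl) (fun _ _ => erefl).

Definition prod_tuple (N : rmod B) (k : forall i, mhom N (M i)) : mhom N prod_rmod.
Proof.
refine (@MHom B N prod_rmod (fun x i => k i x) _ _) => *; apply/functional_extensionality_dep => i /=.
  exact: hfunD.
exact: hfunA.
Defined.

Lemma prod_tupleK (N : rmod B) (k : forall i, mhom N (M i)) i :
  prod_proj i \oc prod_tuple k = k i.
Proof. exact: mhom_ext. Qed.

Lemma prod_ext (N : rmod B) (f g : mhom N prod_rmod) :
  (forall i, prod_proj i \oc f = prod_proj i \oc g) -> f = g.
Proof.
move=> fg; apply: mhom_ext => x; apply/functional_extensionality_dep => i.
by rewrite -[LHS]/((prod_proj i \oc f) x) fg.
Qed.

End Products.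

Section Collecting.
Variables (B : pzRingType) (X Y : finType) (V : zmodType).

(** Relations (I) and (II) on all multi-sets of passages, since the sub-multi-sets of a matrix need
    not be mazes. *)
Definition respects_labels (K : seq (X * Y * B) -> V) :=
  [/\ perm_invariant K, forall x y U, K ((x, y, 0) :: U) = 0 &
      forall x y a b U, K ((x, y, a + b) :: U) =
        K ((x, y, a) :: U) + K ((x, y, b) :: U) + K [:: (x, y, a), (x, y, b) & U]].

Lemma respects_labels_cons K p : respects_labels K -> respects_labels (fun U => K (p :: U)).
Proof.
move=> [Kp K0 KD]; split; first exact: perm_invariant_cons.
  move=> x y U; rewrite -(K0 x y (p :: U)); exact/Kp/perm_swap.
move=> x y a b U; have swap c W : K [:: p, (x, y, c) & W] = K [:: (x, y, c), p & W].
  exact/Kp/perm_swap.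
rewrite !swap KD; congr (_ + _); apply: Kp; rewrite perm_cons; exact: perm_swap.
Qed.

(* By the relations (I) and (II), the sum of [K] over all sub-multisets of [P] is unchanged when parallel passages are merged by adding their labels. *)
Lemma sumsub_collect (P : seq (X * Y * B)) K : respects_labels K ->
  sumsub K P = sumsub K (map (coef (\sum_(p <- P) passage_hom p)) (enum [set: X * Y])).
Proof.
elim: P K => [|[[x y] b] P IH] K KP.
  (* All entries of the zero map have label 0, so (I) leaves only the empty sub-multi-set. *)
  rewrite big_nil; elim: (enum _) => //= u s <-; have [_ K0 _] := KP.
  rewrite (eq_sumsub _ (K' := fun=> 0)) => [|U]; last exact: K0.
  suff -> : sumsub (fun=> 0) (map (coef (0 : mhom (@BX B X) (BX Y))) s) = 0 :> V by rewrite addr0.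
  by elim: s => //= v s ->; rewrite addr0.
rewrite big_cons; set f := \sum_(p <- P) _.
pose c := (f (ebasis B x) : funmod Y) y.
pose C := map (coef f) (enum ([set: X * Y] :\ (x, y))).
have [Kp _ KD] := KP.
have en : perm_eq (enum [set: X * Y]) ((x, y) :: enum ([set: X * Y] :\ (x, y))).
  by rewrite -{1}(setD1K (in_setT (x, y))) perm_enum_setU1 // !inE eqxx.
(* The new passage alters no entry but the one at (x, y), where (II) then applies. *)
have CE : map (coef (passage_hom (x, y, b) + f)) (enum ([set: X * Y] :\ (x, y))) = C.
  apply/eq_in_map => -[x' y']; rewrite mem_enum !inE andbT => ne.
  congr (_, _, _) => /=; rewrite -[RHS]add0r; congr (_ + _); case: eqP => // yy.
  rewrite /ebasis; case: eqP => xx; last by rewrite mulr0.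
  by rewrite xx yy eqxx in ne.
rewrite [RHS](sumsub_perm Kp (perm_map _ en)) [RHS]/= CE.
rewrite [LHS]/= IH // (IH (fun U => K ((x, y, b) :: U))); last exact: respects_labels_cons.
rewrite !(sumsub_perm _ (perm_map _ en)) //; last exact: perm_invariant_cons.
rewrite /= -/C -!addrA; congr (_ + _); rewrite -!sumsubD; apply: eq_sumsub => U.
have -> : coef (passage_hom (x, y, b) + f) (x, y) = (x, y, b + c).
  by congr (_, _, _) => /=; congr (_ + _); rewrite /ebasis !eqxx mulr1.
by rewrite KD addrCA addrA.
Qed.

End Collecting.

Lemma restrict_relabel (B : pzRingType) (X Y : finType) (S : {set X}) (T : {set Y})
    (P : seq ({x | x \in S} * {y | y \in T} * B)) : restrict S T (relabel val val P) = P.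
Proof.
elim: P => //= -[[x y] b] P IH.
by rewrite /restrict /= /oapp /restrict_passage /= !valK; congr (_ :: _).
Qed.

(** A crossing uses every passage of both families and joins equal middle points, so the middle
    supports agree and the outer ones are inherited. *)
Lemma crossing_supports (B : pzRingType) (X Y Z I J : finType) (p : I -> Y * Z * B)
    (q : J -> X * Y * B) (A1 : {set I}) (A2 : {set J}) (U : {set I * J})
    (W := [seq passage_comp (p u.1) (q u.2) | u <- enum U]) :
  crossing p q A1 A2 U ->
  [/\ sources W = sources (map q (enum A2)), targets W = targets (map p (enum A1)) &
      sources (map p (enum A1)) = targets (map q (enum A2))].
Proof.
move=> /and3P[/'forall_implyP m /eqP <- /eqP <-].
rewrite /W !sources_enum !targets_enum -!imset_comp; split => //.
by apply: eq_in_imset => u /m /eqP.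
Qed.

Section ExtendedRepresentation.
Variables (B : pzRingType) (L : mrep B) (HL : linrep_laws L).

(** Off mazes the laws do not even make [Lm] additive, so its values there are replaced by 0. *)
Definition maze_hom (X Y : finType) (P : seq (X * Y * B)) : mhom (Lo L X) (Lo L Y) :=
  match excluded_middle_informative (is_maze P) with
  | left mP => @MHom B (Lo L X) (Lo L Y) (@Lm B L X Y P) (lr_add HL mP) (lr_act HL mP)
  | right _ => 0
  end.

Lemma maze_homE (X Y : finType) (P : seq (X * Y * B)) v :
  is_maze P -> maze_hom P v = Lm L P v.
Proof. by rewrite /maze_hom; case: excluded_middle_informative. Qed.

Lemma maze_hom_eq0 (X Y : finType) (P : seq (X * Y * B)) : ~ is_maze P -> maze_hom P = 0.
Proof. by rewrite /maze_hom; case: excluded_middle_informative. Qed.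

(** Changing a label or doubling a passage does not affect being a maze, so the terms of each
    relation are all mazes or all 0. *)
Lemma maze_hom_labels (X Y : finType) : respects_labels (@maze_hom X Y).
Proof.
have head a b x y P : is_maze ((x : X, y : Y, a : B) :: P) -> is_maze ((x, y, b) :: P) by [].
have rc p (P : seq (X * Y * B)) : perm_eq (p :: P) (rcons P p) by rewrite perm_sym perm_rcons.
have perm : perm_invariant (@maze_hom X Y).
  move=> P P' PP'; case: (pselect (is_maze P)) => mP.
    apply: mhom_ext => v; rewrite !maze_homE //; last exact: maze_perm mP.
    exact: (lr_perm HL).
  by rewrite !maze_hom_eq0 // => mP'; apply: mP; apply: maze_perm mP'; rewrite perm_sym.
split=> // [x y U|x y a b U].
  case: (pselect (is_maze ((x, y, 0) :: U))) => mU; last exact: maze_hom_eq0.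
  rewrite (perm _ _ (rc _ _)); apply: mhom_ext => v; have mU' := maze_perm (rc _ _) mU.
  by rewrite maze_homE // (lr_relI HL).
have rc2 : perm_eq [:: (x, y, a), (x, y, b) & U] (rcons (rcons U (x, y, a)) (x, y, b)).
  by rewrite perm_sym perm_rcons (perm_trans _ (perm_swap _ _ _)) // perm_cons perm_rcons.
case: (pselect (is_maze ((x, y, a) :: U))) => mU.
  rewrite !(perm _ _ (rc _ U)) (perm _ _ rc2); apply: mhom_ext => v.
  have m c := maze_perm (rc _ _) (head _ c _ _ _ mU).
  rewrite -[RHS]/(maze_hom _ v + maze_hom _ v + maze_hom _ v) !maze_homE //.
    exact: (lr_relII HL).
  exact: maze_rcons.
rewrite !maze_hom_eq0 ?addr0 //; try by move/head/(_ a)/mU.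
move=> mab; apply: mU; move: mab => [PX PY].
by split=> z; [move: (PX z)|move: (PY z)]; rewrite /= orbA orbb.
Qed.

Lemma maze_hom_perm (X Y : finType) : perm_invariant (@maze_hom X Y).
Proof. by case: (maze_hom_labels X Y). Qed.

Lemma maze_hom_comp (X Y Z : finType) (P : seq (Y * Z * B)) (Q : seq (X * Y * B)) :
  is_maze P -> is_maze Q ->
  maze_hom P \oc maze_hom Q =
  \sum_(S : {set 'I_(size P) * 'I_(size Q)} | mvalid S) maze_hom (Umaze S).
Proof.
move=> mP mQ; apply: mhom_ext => v; rewrite /= !maze_homE // (lr_comp HL) //.
rewrite msumE sum_hfun big_filter big_enum_cond /=; apply: eq_bigr => S mS.
by rewrite maze_homE //; apply: Umaze_maze.
Qed.

Lemma maze_hom_id (X : finType) : maze_hom (mazeI B X) = hid (Lo L X).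
Proof.
apply: mhom_ext => v; rewrite maze_homE; first exact: (lr_id HL).
exact: mazeI_maze.
Qed.

Lemma maze_hom_linesL (W X Y Z : finType) (s : W -> Y) (g : W -> Z) T (Q : seq (X * W * B)) :
  injective s -> is_maze (lines B s g T) -> is_maze (relabel id s Q) -> targets Q = T ->
  maze_hom (lines B s g T) \oc maze_hom (relabel id s Q) = maze_hom (relabel id g Q).
Proof.
move=> s_inj mP mQ QT; rewrite maze_hom_comp // (sum_mvalid_linesL (@maze_hom_perm _ _)) //.
by rewrite QT eqxx.
Qed.

Lemma maze_hom_linesR (W X Y Z : finType) (s : W -> Y) (h : W -> X) S (P : seq (W * Z * B)) :
  injective s -> is_maze (relabel s id P) -> is_maze (lines B h s S) -> sources P = S ->
  maze_hom (relabel s id P) \oc maze_hom (lines B h s S) = maze_hom (relabel h id P).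
Proof.
move=> s_inj mP mQ PS; rewrite maze_hom_comp // (sum_mvalid_linesR (@maze_hom_perm _ _)) //.
by rewrite PS eqxx.
Qed.

Definition sub_obj (X : finType) (S : {set X}) : rmod B := Lo L {x | x \in S}.

(* [sources P] and [targets P] single out one component, on which every multiset of passages acts as a maze; with all other components 0, the composition law [sub_hom_comp] needs no maze hypothesis. *)
Definition sub_hom (X Y : finType) (S : {set X}) (T : {set Y}) (P : seq (X * Y * B)) :
  mhom (sub_obj S) (sub_obj T) :=
  if (sources P == S) && (targets P == T) then maze_hom (restrict S T P) else 0.

(** Sources and targets ignore labels, so all terms of a relation lie in one block. *)
Lemma sub_hom_labels (X Y : finType) (S : {set X}) (T : {set Y}) :
  respects_labels (@sub_hom X Y S T).
Proof.
have [perm m0 mD] := maze_hom_labels {x | x \in S} {y | y \in T}.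
have sE x y c (U : seq (X * Y * B)) : sources ((x, y, c) :: U) = x |: sources U.
  by apply/setP => z; rewrite !inE /= eq_sym.
have tE x y c (U : seq (X * Y * B)) : targets ((x, y, c) :: U) = y |: targets U.
  by apply/setP => z; rewrite !inE /= eq_sym.
have rE x y c (U : seq (X * Y * B)) (xS : x \in S) (yT : y \in T) :
    restrict S T ((x, y, c) :: U) = (Sub x xS, Sub y yT, c) :: restrict S T U.
  by rewrite /restrict /= /oapp /restrict_passage /= (insubT (mem S) xS) (insubT (mem T) yT).
split.
- move=> P P' PP'; rewrite /sub_hom (perm_sources PP') (perm_targets PP').
  by rewrite (perm _ _ (perm_restrict S T PP')).
- move=> x y U; rewrite /sub_hom sE tE; case: ifP => // /andP[/eqP xS /eqP yT].
  by rewrite rE ?m0 // -?xS -?yT setU11.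
- move=> x y a b U; rewrite /sub_hom !sE !tE !setUA !setUid.
  case: ifP => [/andP[/eqP xS /eqP yT]|_]; last by rewrite !addr0.
  have {}xS : x \in S by rewrite -xS setU11.
  have {}yT : y \in T by rewrite -yT setU11.
  by rewrite !(rE _ _ _ _ xS yT) mD.
Qed.

Lemma sub_hom_perm (X Y : finType) (S : {set X}) (T : {set Y}) :
  perm_invariant (@sub_hom X Y S T).
Proof. by case: (sub_hom_labels S T). Qed.

Lemma sub_hom_relabel (X Y : finType) (S : {set X}) (T : {set Y})
    (P : seq ({x | x \in S} * {y | y \in T} * B)) :
  sub_hom S T (relabel val val P) = maze_hom P.
Proof.
rewrite /sub_hom restrict_relabel sources_relabel targets_relabel; case: ifP => // /negP ST.
rewrite maze_hom_eq0 // => /is_mazeE[PS PT]; apply: ST.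
by rewrite PS PT !val_sub_setT !eqxx.
Qed.

Lemma sub_hom_comp (X Y Z : finType) (S : {set X}) (T : {set Z}) (P : seq (Y * Z * B))
    (Q : seq (X * Y * B)) :
  \sum_(R : {set Y}) sub_hom R T P \oc sub_hom S R Q =
  \sum_(U : {set 'I_(size P) * 'I_(size Q)} | mvalid U) sub_hom S T (Umaze U).
Proof.
case: (boolP [&& sources Q == S, targets P == T & sources P == targets Q]) => [|ne].
  move=> /and3P[/eqP QS /eqP PT /eqP PQ]; rewrite (bigD1 (targets Q)) //= big1 ?addr0; last first.
    by move=> R RQ; rewrite [X in _ \oc X]/sub_hom (eq_sym _ R) (negbTE RQ) andbF hcomp0r.
  set R := targets Q; pose P' := restrict R T P; pose Q' := restrict S R Q.
  have mP' : is_maze P' by have := restrict_maze P; rewrite PQ PT.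
  have mQ' : is_maze Q' by have := restrict_maze Q; rewrite QS.
  have PE : relabel val val P' = P by rewrite relabel_restrict // ?PQ ?PT.
  have QE : relabel val val Q' = Q by rewrite relabel_restrict // ?QS.
  rewrite -{1}PE -{1}QE !sub_hom_relabel maze_hom_comp // sum_mvalid.
  (* P is the relabelled P' only propositionally, so their positions form different types; families
     indexed by the positions of P' and Q' bridge them. *)
  pose p j := let p := tnth (in_tuple P') j in (val p.1.1, val p.1.2, p.2).
  pose q j := let q := tnth (in_tuple Q') j in (val q.1.1, val q.1.2, q.2).
  have Pp : P = map p (enum setT) by rewrite -[LHS]PE {1}(map_tnth_setT P') /relabel -map_comp.
  have Qq : Q = map q (enum setT) by rewrite -[LHS]QE {1}(map_tnth_setT Q') /relabel -map_comp.
  rewrite (sum_mvalid_enum (@sub_hom_perm _ _ S T) Pp Qq).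
  apply: eq_bigr => U _; rewrite -sub_hom_relabel; congr sub_hom.
  by rewrite /relabel -map_comp.
(* With mismatched supports no crossing yields a term in block (S, T), and each product has a factor
   0. *)
rewrite big1 => [|R _].
  rewrite sum_mvalid; symmetry; apply: big1 => U /crossing_supports[].
  rewrite -!map_tnth_setT => WS WT PQ; rewrite /sub_hom WS WT; case: ifP => // /andP[QS PT].
  by move: ne; rewrite QS PT PQ eqxx.
rewrite /sub_hom; case: ifP => [/andP[/eqP PR PT]|_]; last by rewrite hcomp0l.
case: ifP => [/andP[QS /eqP QR]|_]; last by rewrite hcomp0r.
by move: ne; rewrite QS PT PR QR eqxx.
Qed.

Lemma sub_hom_comp_enum (X Y Z I J : finType) (S : {set X}) (T : {set Z})
    (p : I -> Y * Z * B) (q : J -> X * Y * B) (A1 : {set I}) (A2 : {set J}) :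
  \sum_(R : {set Y}) sub_hom R T (map p (enum A1)) \oc sub_hom S R (map q (enum A2)) =
  crossing_sum (sub_hom S T) p q A1 A2.
Proof.
by rewrite sub_hom_comp; apply: sum_mvalid_enum => //; exact: sub_hom_perm.
Qed.

Lemma sub_hom_id (X : finType) (S : {set X}) : sub_hom S S (lines B id id S) = hid (sub_obj S).
Proof.
rewrite -maze_hom_id -sub_hom_relabel; apply: sub_hom_perm.
have SE : perm_eq (enum S) (map val (enum {: {x | x \in S}})).
  have -> : enum {: {x | x \in S}} = enum [set: {x | x \in S}].
    by apply: eq_enum => x; rewrite in_setT.
  by rewrite -{1}(val_sub_setT S); apply: perm_enum_imset val_inj.
rewrite (perm_trans (perm_map _ SE)) //.
by rewrite /relabel /mazeI -!map_comp.
Qed.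

Lemma sub_hom_ne (X Y : finType) (S : {set X}) (T : {set Y}) P :
  (S != sources P) || (T != targets P) -> sub_hom S T P = 0.
Proof.
by rewrite /sub_hom eq_sym (eq_sym T) -negb_and; case: ifP.
Qed.

End ExtendedRepresentation.

Section Realization.
Variables (B : pzRingType) (L : mrep B) (HL : linrep_laws L).

Notation K := (sub_hom HL).

Definition real_obj (X : finType) : rmod B := prod_rmod (fun S : {set X} => sub_obj L S).

Definition mx_hom (X Y : finType)
    (k : forall (S : {set X}) (T : {set Y}), mhom (sub_obj L S) (sub_obj L T)) :
  mhom (real_obj X) (real_obj Y) :=
  prod_tuple (fun T => \sum_S k S T \oc prod_proj _ S).

Lemma mx_homE (X Y : finType)
    (k : forall (S : {set X}) (T : {set Y}), mhom (sub_obj L S) (sub_obj L T)) T :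
  prod_proj _ T \oc mx_hom k = \sum_S k S T \oc prod_proj _ S.
Proof. exact: prod_tupleK. Qed.

Lemma eq_mx_hom (X Y : finType)
    (k k' : forall (S : {set X}) (T : {set Y}), mhom (sub_obj L S) (sub_obj L T)) :
  (forall S T, k S T = k' S T) -> mx_hom k = mx_hom k'.
Proof.
by move=> kk'; apply: prod_ext => T; rewrite !mx_homE; apply: eq_bigr => S _; rewrite kk'.
Qed.

Lemma mx_hom_sum (X Y I : finType) (Pr : pred I)
    (k : I -> forall (S : {set X}) (T : {set Y}), mhom (sub_obj L S) (sub_obj L T)) :
  mx_hom (fun S T => \sum_(i | Pr i) k i S T) = \sum_(i | Pr i) mx_hom (k i).
Proof.
apply: prod_ext => T; rewrite mx_homE hcomp_sumr.
under [RHS]eq_bigr do rewrite mx_homE.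
rewrite exchange_big; apply: eq_bigr => S _; exact: hcomp_suml.
Qed.

Lemma mx_hom_comp (X Y Z : finType)
    (k : forall (S : {set X}) (T : {set Y}), mhom (sub_obj L S) (sub_obj L T))
    (k' : forall (S : {set Y}) (T : {set Z}), mhom (sub_obj L S) (sub_obj L T)) :
  mx_hom k' \oc mx_hom k = mx_hom (fun S T => \sum_R k' R T \oc k S R).
Proof.
apply: prod_ext => T; rewrite mx_homE hcompA mx_homE hcomp_suml.
under eq_bigr do rewrite -hcompA mx_homE hcomp_sumr.
rewrite exchange_big; apply: eq_bigr => S _; rewrite hcomp_suml.
by apply: eq_bigr => R _; rewrite hcompA.
Qed.

Definition real_hom (X Y : finType) (f : mhom (BX X) (BX Y)) : mhom (real_obj X) (real_obj Y) :=
  mx_hom (fun S T => sumsub (K S T) (map (coef f) (enum [set: X * Y]))).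

Lemma real_hom_passages (X Y : finType) (P : seq (X * Y * B)) :
  real_hom (\sum_(p <- P) passage_hom p) = mx_hom (fun S T => sumsub (K S T) P).
Proof. by apply: eq_mx_hom => S T; rewrite [RHS]sumsub_collect //; apply: sub_hom_labels. Qed.

Lemma real_hom_sum (X Y I : finType) (p : I -> X * Y * B) (A : {set I}) :
  real_hom (\sum_(i in A) passage_hom (p i)) =
  \sum_(S : {set I} | S \subset A) mx_hom (fun S' T => K S' T (map p (enum S))).
Proof.
rewrite -mx_hom_sum -big_enum -(big_map p xpredT (@passage_hom B X Y)) real_hom_passages.
by apply: eq_mx_hom => S T; apply: sumsub_enum; apply: sub_hom_perm.
Qed.

(** Proved for all subfamilies of P at once, because Moebius inversion needs every subset. *)
Lemma dv_real_hom (X Y : finType) (P : seq (X * Y * B)) :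
  dv (@real_hom X Y) (map (@passage_hom B X Y) P) = mx_hom (fun S T => K S T P).
Proof.
pose p := tnth (in_tuple P).
suff E (A : {set 'I_(size P)}) : dv (@real_hom X Y) (map (@passage_hom B X Y \o p) (enum A)) =
    mx_hom (fun S T => K S T (map p (enum A))).
  by rewrite [in LHS](map_tnth_setT P) -map_comp E -map_tnth_setT.
move: A; apply: moebius_unique => A.
by rewrite -fun_sum_dv real_hom_sum.
Qed.

Lemma real_hom_id (X : finType) : real_hom (hid (BX X)) = hid (real_obj X).
Proof.
have -> : hid (BX X) = \sum_(x in [set: X]) passage_hom (x, x, 1 : B).
  by rewrite hid_passages; apply: eq_bigl => x; rewrite inE.
(* The passages x -> x with x in A act as the identity of block A and as 0 elsewhere, so only A = T
   reaches T. *)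
rewrite real_hom_sum; apply: prod_ext => T; rewrite hcomp_sumr hcomp1r (bigD1 T) ?subsetT //=.
rewrite mx_homE (bigD1 T) //= -/(lines B id id T) sub_hom_id hcomp1l big1; last first.
  by move=> S ST; rewrite sub_hom_ne ?hcomp0l // sources_enum imset_id ST.
rewrite addr0 big1 ?addr0 // => A /andP[_ AT]; rewrite mx_homE big1 // => S _.
by rewrite sub_hom_ne ?hcomp0l // targets_enum imset_id (eq_sym T) AT orbT.
Qed.

(** Compatible pairs of entries give a multi-set of passages with sum [g \oc f], not its matrix; by
    [real_hom_sum] this suffices. Sorting its subsets by their projections yields crossing sums,
    which are products of blocks. *)
Lemma real_hom_comp (X Y Z : finType) (g : mhom (BX Y) (BX Z)) (f : mhom (BX X) (BX Y)) :
  real_hom (g \oc f) = real_hom g \oc real_hom f.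
Proof.
pose C := [set u : (Y * Z) * (X * Y) | meets (coef g u.1) (coef f u.2)].
pose pq (u : (Y * Z) * (X * Y)) := passage_comp (coef g u.1) (coef f u.2).
have -> : g \oc f = \sum_(u in C) passage_hom (pq u).
  rewrite {1}(sum_coef g) {1}(sum_coef f) hcomp_suml.
  under eq_bigr do rewrite hcomp_sumr.
  rewrite pair_big [RHS]big_mkcond /=; apply: eq_bigr => u _.
  by rewrite passage_hom_comp inE; case: (meets _ _).
rewrite real_hom_sum mx_hom_comp -mx_hom_sum; apply: eq_mx_hom => S T.
transitivity (\sum_(A1 : {set Y * Z} | A1 \subset setT) \sum_(A2 : {set X * Y} | A2 \subset setT)
    crossing_sum (K S T) (coef g) (coef f) A1 A2).
  rewrite big_mkcond (eq_bigl (fun U : {set (Y * Z) * (X * Y)} => U \subset setX setT setT)).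
    rewrite sum_proj_setX; apply: eq_bigr => A1 _; apply: eq_bigr => A2 _.
    rewrite -big_mkcondr; apply: eq_bigl => U; rewrite andbC; congr (_ && _).
    by apply/subsetP/'forall_implyP => UC u /UC; rewrite inE.
  by move=> U; apply/esym/subsetP => -[u v]; rewrite !inE.
transitivity (\sum_R \sum_(A1 : {set Y * Z} | A1 \subset setT) \sum_(A2 : {set X * Y} | A2 \subset setT)
    K R T (map (coef g) (enum A1)) \oc K S R (map (coef f) (enum A2))).
  rewrite [RHS]exchange_big; apply: eq_bigr => A1 _; rewrite [RHS]exchange_big.
  by apply: eq_bigr => A2 _; rewrite sub_hom_comp_enum.
apply: eq_bigr => R _; rewrite !sumsub_enum; try exact: sub_hom_perm.
by rewrite hcomp_suml; apply: eq_bigr => A1 _; rewrite hcomp_sumr.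
Qed.

(* Transported along the chosen bases, since [modfun] is defined on all free modules. *)
Definition realization : modfun B.
Proof.
refine (@ModFun B (fun M => real_obj (basis M))
  (fun M N f => real_hom (coords N \oc f \oc lincomb M)) _ _).
  by move=> M x; rewrite hcomp1r lincombK real_hom_id.
move=> M N P g f x; rewrite -[RHS]/((real_hom _ \oc real_hom _) x) -real_hom_comp.
congr (hfun (real_hom _) x).
by rewrite !hcompA -(hcompA _ (lincomb N) (coords N)) coordsK hcomp1r.
Defined.

(** Change of basis from the one chosen for [BX X] to X itself. *)
Definition real_in (X : finType) : mhom (Fo realization (BX X)) (real_obj X) :=
  real_hom (lincomb (BX X)).
Definition real_out (X : finType) : mhom (real_obj X) (Fo realization (BX X)) :=
  real_hom (coords (BX X)).

Lemma real_inK (X : finType) : real_out X \oc real_in X = hid _.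
Proof. by rewrite -real_hom_comp lincombK real_hom_id. Qed.

Lemma real_outK (X : finType) : real_in X \oc real_out X = hid _.
Proof. by rewrite -real_hom_comp coordsK real_hom_id. Qed.

Lemma real_in_nat (X Y : finType) (f : mhom (BX X) (BX Y)) :
  real_in Y \oc Fm realization f = real_hom f \oc real_in X.
Proof. by rewrite -!real_hom_comp !hcompA coordsK hcomp1l. Qed.

Definition sub_mx (X Y : finType) (P : seq (X * Y * B)) : mhom (real_obj X) (real_obj Y) :=
  mx_hom (fun S T => K S T P).

Lemma real_in_mdv (X Y : finType) (P : seq (X * Y * B)) :
  real_in Y \oc mdv realization P = sub_mx P \oc real_in X.
Proof.
rewrite /sub_mx -dv_real_hom hcomp_dvr hcomp_dvl.
by apply: eq_dev => f; exact: real_in_nat.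
Qed.

(** The top block is L at the type of elements of [setT], a finite set different from X; L of a
    bijective maze compares them. *)
Definition top_in (X : finType) : mhom (sub_obj L [set: X]) (Lo L X) :=
  maze_hom HL (sub_in B [set: X]).
Definition top_out (X : finType) : mhom (Lo L X) (sub_obj L [set: X]) :=
  maze_hom HL (sub_out B [set: X]).

Lemma sub_in_top_maze (X : finType) : is_maze (sub_in B [set: X]).
Proof. by apply/is_mazeE; rewrite sources_sub_in targets_sub_in. Qed.

Lemma sub_out_top_maze (X : finType) : is_maze (sub_out B [set: X]).
Proof. by apply/is_mazeE; rewrite sources_sub_out targets_sub_out. Qed.

Lemma top_outK (X : finType) : top_in X \oc top_out X = hid _.
Proof.
rewrite /top_in /top_out -(relabel_id (sub_out B _)).
have mO : is_maze (relabel id id (sub_out B [set: X])).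
  by rewrite relabel_id; apply: sub_out_top_maze.
rewrite (maze_hom_linesL HL (@inj_id _) (sub_in_top_maze X) mO (targets_sub_out _ _)).
rewrite -maze_hom_id; apply: maze_hom_perm; rewrite mazeI_lines.
have SE : perm_eq (enum [set: X]) (map val (enum [set: {x | x \in [set: X]}])).
  by rewrite -{1}(val_sub_setT [set: X]); apply: perm_enum_imset val_inj.
rewrite perm_sym (perm_trans (perm_map _ SE)) //.
by rewrite /relabel /sub_out /lines -!map_comp.
Qed.

Lemma top_inK (X : finType) : top_out X \oc top_in X = hid _.
Proof.
have inE : sub_in B [set: X] = relabel id val (mazeI B {x | x \in [set: X]}).
  by rewrite mazeI_lines /relabel /lines -map_comp.
have [IS IT] := (is_mazeE _).1 (mazeI_maze B {x | x \in [set: X]}).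
have mI : is_maze (relabel id val (mazeI B {x | x \in [set: X]})).
  by rewrite -inE; apply: sub_in_top_maze.
rewrite /top_in /top_out inE (maze_hom_linesL HL val_inj (sub_out_top_maze X) mI IT).
by rewrite relabel_id maze_hom_id.
Qed.

Lemma top_in_nat (X Y : finType) (P : seq (X * Y * B)) : is_maze P ->
  top_in Y \oc K setT setT P = maze_hom HL P \oc top_in X.
Proof.
move=> mP; have [PS PT] := (is_mazeE _).1 mP.
pose P' := restrict setT setT P; have mP' : is_maze P'.
  by have := restrict_maze P; rewrite PS PT.
have [P'S P'T] := (is_mazeE _).1 mP'.
have PE : P = relabel val id (relabel id val P').
  by rewrite relabel_comp relabel_restrict ?subsetT.
have mP1 : is_maze (relabel id id P') by rewrite relabel_id.
have mP2 : is_maze (relabel val id (relabel id val P')) by rewrite -PE.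
have P2S : sources (relabel id val P') = setT by rewrite sources_relabel imset_id.
rewrite /sub_hom PS PT !eqxx -/P' [in RHS]PE /top_in.
rewrite (maze_hom_linesR HL val_inj mP2 (sub_in_top_maze X) P2S) relabel_comp -{1}(relabel_id P').
exact: (maze_hom_linesL HL (@inj_id _) (sub_in_top_maze Y) mP1 P'T).
Qed.

(** The identity at T = [setT] and 0 at other T, written through [sub_hom] to avoid casts between
    the types [sub_obj L T]. *)
Definition top_incl (X : finType) : mhom (sub_obj L [set: X]) (real_obj X) :=
  prod_tuple (fun T => K setT T (mazeI B X)).
Definition top_proj (X : finType) : mhom (real_obj X) (sub_obj L [set: X]) :=
  prod_proj _ setT.

(** The idempotent that cuts out the cross-effect is the projection onto the top block, which is why
    cr_X of the realization is L(X). *)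
Lemma sub_mx_mazeI (X : finType) : sub_mx (mazeI B X) = top_incl X \oc top_proj X.
Proof.
have [IS IT] := (is_mazeE _).1 (mazeI_maze B X).
apply: prod_ext => T; rewrite mx_homE hcompA prod_tupleK (bigD1 setT) //= big1 ?addr0 //.
by move=> S ST; rewrite sub_hom_ne ?hcomp0l // IS ST.
Qed.

Lemma top_inclK (X : finType) : top_proj X \oc top_incl X = hid _.
Proof. by rewrite prod_tupleK mazeI_lines sub_hom_id. Qed.

Lemma top_proj_nat (X Y : finType) (P : seq (X * Y * B)) : is_maze P ->
  top_proj Y \oc sub_mx P = K setT setT P \oc top_proj X.
Proof.
case/is_mazeE=> PS PT; rewrite mx_homE (bigD1 setT) //= big1 ?addr0 // => S ST.
by rewrite sub_hom_ne ?hcomp0l // PS ST.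
Qed.

Definition unit_to (X : finType) : mhom (cr realization X) (Lo L X) :=
  top_in X \oc top_proj X \oc real_in X \oc cr_incl realization X.
Definition unit_from (X : finType) : mhom (Lo L X) (cr realization X) :=
  cr_proj realization X \oc real_out X \oc top_incl X \oc top_out X.

Lemma unit_toK (X : finType) : unit_from X \oc unit_to X = hid _.
Proof.
rewrite /unit_from /unit_to !hcompA -(hcompA _ (top_out X)) top_inK hcomp1r.
rewrite -(hcompA _ (top_incl X)) -sub_mx_mazeI -(hcompA _ (sub_mx _)) -real_in_mdv.
rewrite !hcompA -(hcompA _ (real_out X)) real_inK hcomp1r -(cr_projK realization).
by rewrite !hcompA cr_inclK hcomp1l cr_inclK.
Qed.

Lemma unit_fromK (X : finType) : unit_to X \oc unit_from X = hid _.
Proof.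
rewrite /unit_from /unit_to !hcompA -(hcompA _ (cr_incl _ X)) cr_projK -(hcompA _ (real_in X)).
rewrite real_in_mdv sub_mx_mazeI !hcompA -(hcompA _ (real_in X)) real_outK hcomp1r.
rewrite -(hcompA _ (top_proj X) (top_incl X)) top_inclK hcomp1r.
by rewrite -(hcompA _ (top_proj X) (top_incl X)) top_inclK hcomp1r top_outK.
Qed.

Lemma unit_to_nat (X Y : finType) (P : seq (X * Y * B)) : is_maze P ->
  unit_to Y \oc mazeM realization P = maze_hom HL P \oc unit_to X.
Proof.
move=> mP; have [_ PT] := (is_mazeE _).1 mP.
rewrite /unit_to -(hcompA _ (cr_incl _ Y)) cr_incl_mazeM // !hcompA.
rewrite -(hcompA _ (real_in Y)) real_in_mdv !hcompA -(hcompA _ (top_proj Y)) top_proj_nat //.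
by rewrite !hcompA top_in_nat.
Qed.

Lemma unit_from_nat (X Y : finType) (P : seq (X * Y * B)) : is_maze P ->
  unit_from Y \oc maze_hom HL P = mazeM realization P \oc unit_from X.
Proof.
move=> mP; rewrite -[LHS]hcomp1r -(unit_fromK X) (hcompA _ (unit_to X)).
rewrite -(hcompA (unit_from Y) (maze_hom HL P) (unit_to X)) -unit_to_nat //.
by rewrite (hcompA (unit_from Y) (unit_to Y)) unit_toK hcomp1l.
Qed.

Lemma Phi_realization : rep_iso (Phi realization) L.
Proof.
exists (fun X v => unit_to X v), (fun X v => unit_from X v); split.
- split=> [X u v|X u b|X Y P mP v]; [exact: hfunD|exact: hfunA|].
  rewrite /= (phiLmE _ mP) -(maze_homE HL _ mP).
  exact: (congr1 (fun f => hfun f v) (unit_to_nat mP)).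
- split=> [X u v|X u b|X Y P mP v]; [exact: hfunD|exact: hfunA|].
  rewrite /= (phiLmE _ mP) -(maze_homE HL _ mP).
  exact: (congr1 (fun f => hfun f v) (unit_from_nat mP)).
- move=> X v; exact: (congr1 (fun f => hfun f v) (unit_toK X)).
- move=> X v; exact: (congr1 (fun f => hfun f v) (unit_fromK X)).
Qed.

End Realization.

Theorem mainTheorem1 (B : pzRingType) :
  (* Phi(F) on a maze: F(<>_{p in P} pbar sigma_{y_p x_p}) maps cr_X F(B) into cr_Y F(B) *)
  (forall (F : modfun B) (X Y : finType) (P : seq (X * Y * B)), is_maze P ->
     forall v : cr F X, crP F Y (dia F (mazehoms P) (sval v))) /\
  (* Phi(F) is an additive functor Laby -> Mod *)
  (forall F : modfun B, linrep_laws (Phi F)) /\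
  (* Phi(zeta) restricts to cr_X F(B) -> cr_X G(B) ... *)
  (forall (F G : modfun B) (z : nattr F G) (X : finType) (v : cr F X),
     crP G X (ntc z (BX X) (sval v))) /\
  (* ... and is a morphism in Lin(Laby, Mod) *)
  (forall (F G : modfun B) (z : nattr F G), repmorph_laws (phi_nt z)) /\
  (* Phi is a functor *)
  (forall (F : modfun B) (X : finType) (v : Lo (Phi F) X), phi_nt (nt_id F) v = v) /\
  (forall (F G H : modfun B) (z : nattr G H) (w : nattr F G) (X : finType)
          (v : Lo (Phi F) X),
     phi_nt (nt_comp z w) v = phi_nt z (phi_nt w v)) /\
  (* Phi is faithful *)
  (forall (F G : modfun B) (z w : nattr F G),
     (forall (X : finType) (v : Lo (Phi F) X), phi_nt z v = phi_nt w v) ->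
     forall (M : xobj B) (x : Fo F M), ntc z M x = ntc w M x) /\
  (* Phi is full *)
  (forall (F G : modfun B) (e : forall X : finType, Lo (Phi F) X -> Lo (Phi G) X),
     repmorph_laws e ->
     exists z : nattr F G, forall (X : finType) (v : Lo (Phi F) X), phi_nt z v = e X v) /\
  (* Phi is essentially surjective *)
  (forall L : mrep B, linrep_laws L -> exists F : modfun B, rep_iso (Phi F) L).
Proof.
split; last split; last split; last split; last split; last split; last split; last split.
- by move=> F X Y P /is_mazeE[_ PT] v; rewrite dia_mazehoms; apply: mdv_crP.
- exact: Phi_laws.
- by move=> F G z X v; apply: ntc_crP.
- exact: phi_nt_laws.
- move=> F X v; rewrite phi_ntE.
  by rewrite /ntM hcomp1r cr_inclK.
- move=> F G H z w X v; rewrite !phi_ntE -[RHS]/((ntM z X \oc ntM w X) v).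
  (* The component of w already maps the cross-effect of F into that of G, so restricting in between
     changes nothing. *)
  congr (hfun _ v); rewrite /(ntM z X) -hcompA cr_incl_ntM.
  by rewrite !hcompA -(hcompA (cr_proj H X)).
- exact: Phi_faithful.
- by move=> F G e; apply: Phi_full.
- by move=> L HL; exists (realization HL); apply: Phi_realization.
Qed.
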